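(* Let $K$ be an algebraically closed field, let $n\ge 1$, and let $I\subset\mathbb{N}^n$ be finite and nonempty. Then $Z_I=V_I$ (that is, every polynomial in $K[X_1,\dots,X_n]$ with support exactly $I$ is reducible) if and only if one of the following holds: (i) $I\subseteq e_t+\mathbb{N}^n$ and $I\neq\{e_t\}$ for some $t\in\{1,\dots,n\}$. (ii) There are $i=(i_1,\dots,i_n)$ and $j=(j_1,\dots,j_n)$ in $\mathbb{N}^n$ with $i_tj_t=0$ for all $t$ and $\gcd\{i_1,\dots,i_n,j_1,\dots,j_n\}>1$ such that $i,j\in I\subseteq[i,j]:=\{(1-\lambda)i+\lambda j\mid 0\le\lambda\le 1\}$. (iii) $\operatorname{char}K=p$ and $\{0\}\neq I\subseteq p\mathbb{N}^n$ for some prime $p$.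
   Context: $\mathbb{N}$ denotes the set of all non-negative integers (including $0$). For $i=(i_1,\dots,i_n)\in\mathbb{N}^n$, $X^i=X_1^{i_1}\cdots X_n^{i_n}$. The support of $P\in K[X]=K[X_1,\dots,X_n]$ is the finite set $I(P)\subset\mathbb{N}^n$ such that $P=\sum_{i\in I(P)}a_iX^i$ with all $a_i\in K^*=K\setminus\{0\}$. A polynomial is reducible (decomposable) if it is a product of two nonconstant polynomials in $K[X]$; in particular nonzero constants are not reducible. For finite nonempty $I\subset\mathbb{N}^n$, $V_I=\{P\in K[X]\mid I(P)=I\}$ and $Z_I=\{P\in V_I\mid P\text{ is reducible}\}$. $e_1,\dots,e_n$ is the canonical basis of $\mathbb{Z}^n$. The gcd of a set consisting only of zeros is $0$. *)

(* Defs.v *)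
From mathcomp Require Import all_boot all_order all_algebra.
From mathcomp Require Import finmap.
From mathcomp Require Import classical_sets reals.
From mathcomp Require Import mpoly.

Set Implicit Arguments.
Unset Strict Implicit.
Unset Printing Implicit Defensive.

Import GRing.Theory Num.Theory.

Local Open Scope classical_set_scope.
Local Open Scope fset_scope.
Local Open Scope ring_scope.

Definition mpoly_const (n : nat) (K : fieldType) (P : {mpoly K[n]}) : Prop :=
  exists c : K, P = c%:MP.

Definition mpoly_reducible (n : nat) (K : fieldType) (P : {mpoly K[n]}) : Prop :=
  exists A B : {mpoly K[n]},
    [/\ ~ mpoly_const A, ~ mpoly_const B & P = A * B].

Definition Vsupp (K : fieldType) (n : nat) (I : {fset 'X_{1..n}}) :
    set {mpoly K[n]} :=
  [set P | msupp P =i I].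

Arguments Vsupp K {n} I.

Definition Zsupp (K : fieldType) (n : nat) (I : {fset 'X_{1..n}}) :
    set {mpoly K[n]} :=
  [set P | Vsupp K I P /\ mpoly_reducible P].

Arguments Zsupp K {n} I.

Definition mnm_shift (n : nat) (t : 'I_n) : set 'X_{1..n} :=
  [set (U_(t) + m)%MM | m in [set: 'X_{1..n}]].

Definition mnm_multiples (n p : nat) : set 'X_{1..n} :=
  [set (m *+ p)%MM | m in [set: 'X_{1..n}]].

(* Lattice points of the real segment with endpoints i and j. *)
Definition mnm_segment (R : realType) (n : nat) (i j : 'X_{1..n}) :
    set 'X_{1..n} :=
  [set m : 'X_{1..n} | exists l : R, [/\ 0 <= l, l <= 1 &
     forall t : 'I_n,
       (m t)%:R = (1 - l) * (i t)%:R + l * (j t)%:R]].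

Definition mnm_gcd (n : nat) (i j : 'X_{1..n}) : nat :=
  gcdn (\big[gcdn/0%N]_(t < n) i t) (\big[gcdn/0%N]_(t < n) j t).

Definition cond_shift (n : nat) (I : {fset 'X_{1..n}}) : Prop :=
  exists t : 'I_n,
    ([set` I] `<=` mnm_shift t)%classic /\ I <> [fset U_(t)%MM].

Definition cond_segment (R : realType) (n : nat) (I : {fset 'X_{1..n}}) : Prop :=
  exists i j : 'X_{1..n},
    [/\ forall t : 'I_n, (i t * j t = 0)%N,
        (1 < mnm_gcd i j)%N,
        i \in I, j \in I & ([set` I] `<=` mnm_segment R i j)%classic].

Definition cond_char (K : fieldType) (n : nat) (I : {fset 'X_{1..n}}) : Prop :=
  exists p : nat,
    [/\ prime p, p \in [pchar K], I <> [fset 0%MM] &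
        ([set` I] `<=` @mnm_multiples n p)%classic].

(* Main.v *)
Require Import Defs.
From mathcomp Require Import all_boot all_order all_algebra.
From mathcomp Require Import finmap.
From mathcomp Require Import classical_sets reals.
From mathcomp Require Import mpoly.
From mathcomp Require Import boolp ring zify.

(* If no condition holds, some coefficient vector gives an irreducible polynomial. When I lies on
   a line, I = {i,j} with gcd 1 and X^i + X^j is irreducible because its factors have supports on
   lines parallel to i - j. Otherwise a Kronecker substitution X_t -> x^(B^t) y^[t = t0] reduces
   to two variables, where one takes a pencil F + sG of polynomials with sum of coefficients 0,
   F and G coprime. Every member passes smoothly through (1,1) along a branch with coefficients
   in K[s], so if all members are reducible, a factor of smaller x-degree vanishes on the branch
   for infinitely many s. This is a linear condition on the factor, hence it is also met
   generically by some A in K[s][y][x]. Eliminating s = -F/G turns A into a polynomial H in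
   K[y][x] vanishing on all branches, so H = 0, and coprimality of F and G gives A = 0.
   Inseparability in characteristic p is absorbed by a weighted choice of the branch. *)

Set Implicit Arguments.
Unset Strict Implicit.
Unset Printing Implicit Defensive.
Import Order.TTheory GRing.Theory Num.Theory.
Local Open Scope ring_scope.

(** * Linear systems depending on a parameter *)

Section Cofinite.
Variable K : fieldType.

(** The obstacle is that a factorization of F + sG may depend on s in an uncontrolled, algebraic
    way. So only the vanishing of one factor along the branch is retained. Since the degrees of the
    factors are bounded in advance, solvability passes from infinitely many s to the generic s
    without any algebraic extension of K(s). The first-order data of F and G are normalized so that
    the branch equation reads V = s + higher order terms in tau. This makes the branch polynomial in
    s modulo each power of tau. It also makes s the initial slope, so that the branches together
    dominate the plane. The normalization is possible only if the exponent differences have rank 2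
    over K, not merely over the integers; this is where characteristic p intervenes. It suffices to
    show that one bivariate factor is constant in x: after the Kronecker substitution such a factor
    comes from a single monomial, which is impossible when no variable divides all monomials of
    I. *)

Definition cofinite (P : K -> Prop) := exists s : seq K, forall c, c \notin s -> P c.

Lemma cofiniteI (P Q : K -> Prop) :
  cofinite P -> cofinite Q -> cofinite (fun c => P c /\ Q c).
Proof.
move=> [s Ps] [t Qt]; exists (s ++ t) => c; rewrite mem_cat negb_or.
by case/andP=> /Ps ? /Qt.
Qed.

Lemma cofinite_all (T : eqType) (r : seq T) (P : T -> K -> Prop) :
  (forall l, l \in r -> cofinite (P l)) ->
  cofinite (fun c => forall l, l \in r -> P l c).
Proof.
elim: r => [|x r IH] Pr; first by exists [::].
have [s Ps] : cofinite (P x) by apply: Pr; rewrite mem_head.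
have [|t Pt] := IH; first by move=> l lr; apply: Pr; rewrite inE lr orbT.
exists (s ++ t) => c; rewrite mem_cat negb_or => /andP[/Ps Px /Pt Pr'] l.
by rewrite inE => /orP[/eqP->|/Pr'].
Qed.

Lemma cofinite_affine (u v : K) :
  (u != 0) || (v != 0) -> cofinite (fun c => u + c * v != 0).
Proof.
have [->|v0 _] := eqVneq v 0.
  by rewrite orbF => u0; exists [::] => c _; rewrite mulr0 addr0.
exists [:: - u / v] => c; rewrite inE; apply: contra.
by rewrite addrC addr_eq0 => /eqP <-; rewrite mulfK.
Qed.

Lemma cofinite_horner (p : {poly K}) : p != 0 -> cofinite (fun c => p.[c] != 0).
Proof.
have [k] := ubnP (size p); elim: k p => [//|k IHk] p /ltnSE sp p0.
have [[s rs]|nr] := pselect (exists s, root p s); last first.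
  by exists [::] => s _; apply/negP => rs; case: nr; exists s.
have /factor_theorem[q qE] := rs.
have q0 : q != 0 by apply: contraNneq p0 => qq; rewrite qE qq mul0r.
have [|r Hr] := IHk q _ q0.
  by move: sp; rewrite qE size_Mmonic ?monicXsubC // size_XsubC addn2.
exists (s :: r) => t; rewrite inE negb_or => /andP[ts tr].
by rewrite qE hornerM mulf_neq0 ?Hr // hornerXsubC subr_eq0.
Qed.

End Cofinite.

Lemma cofinite_ex (K : closedFieldType) (P : K -> Prop) : cofinite P -> exists c, P c.
Proof.
(* [q] takes the value 1 on [s], so its root lies outside [s]; the extra factor ['X] keeps [q]
   nonconstant when [s] is empty. *)
move=> [s Ps]; pose q : {poly K} := \prod_(a <- s) ('X - a%:P) * 'X + 1.
have sq : size q != 1%N.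
  rewrite /q -polyC1 size_MXaddC oner_eq0 andbF size_prod_XsubC //.
have [c rc] := closed_rootP q sq; exists c; apply: Ps; apply/negP => cs.
move: rc; rewrite /root /q hornerD hornerM hornerC.
have /eqP -> : root (\prod_(a <- s) ('X - a%:P)) c by rewrite root_prod_XsubC.
by rewrite mul0r add0r oner_eq0.
Qed.

(** Fraction-free Gaussian elimination, by induction on the number of unknowns. Each round uses a
    single pivot equation, so the family of equations may be infinite. *)
Lemma pencil_kernel (K : fieldType) (J : Type) (w : nat) (c : J -> nat -> {poly K}) :
  (forall bad : seq K, exists2 s, s \notin bad &
     exists2 u : nat -> K, (exists2 t, (t < w)%N & u t != 0) &
       forall e, \sum_(0 <= t < w) u t * (c e t).[s] = 0) ->
  exists2 u : nat -> {poly K}, (exists2 t, (t < w)%N & u t != 0) &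
    forall e, \sum_(0 <= t < w) u t * c e t = 0.
Proof.
elim: w c => [|w IH] c Hc; first by have [s _ [u [t]]] := Hc [::].
have [c0|] := pselect (forall e, c e 0%N = 0).
  exists (fun t => (t == 0%N)%:R); first by exists 0%N; rewrite //= oner_eq0.
  move=> e; rewrite big_nat_recl // c0 mulr0 add0r big1 // => i _.
  by rewrite mul0r.
move=> /existsNP[e0 /eqP pi0]; set pi := c e0 0%N in pi0.
(* The pivot equation [e0] eliminates the first unknown; the roots of the pivot [pi] join the values
   of s to avoid. *)
have {}[] := IH (fun e t => pi * c e t.+1 - c e 0%N * c e0 t.+1).
  have [rs Hrs] := cofinite_horner pi0.
  move=> bad; have [s] := Hc (rs ++ bad); rewrite mem_cat negb_or => /andP[srs sbad].
  move=> [u [t tw ut] uc]; exists s => //.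
  have pis : pi.[s] != 0 by exact: Hrs.
  have uc0 := uc e0; rewrite big_nat_recl // -/pi in uc0.
  (* If all entries of [u] but the first were zero, the pivot equation would force the first to
     vanish as well, because [pi] is nonzero at s. *)
  exists (fun t => u t.+1).
    apply: contrapT => nz.
    have nz' k : (k < w)%N -> u k.+1 = 0.
      by move=> kw; apply/eqP; apply: contrapT => /negP uk; case: nz; exists k.
    case: t tw ut => [|t] tw; last by rewrite nz' ?eqxx.
    move: uc0; rewrite big_nat big1 ?addr0 => [/eqP|i /andP[_ iw]]; last by rewrite nz' ?mul0r.
    by rewrite mulf_eq0 (negPf pis) orbF => -> .
  move=> e; have uce := uc e; rewrite big_nat_recl // in uce.
  under eq_bigr do rewrite hornerD hornerN !hornerM mulrBr.
  rewrite sumrB.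
  under eq_bigr do rewrite mulrCA.
  rewrite -big_distrr /=.
  under [X in _ - X]eq_bigr do rewrite mulrCA.
  rewrite -big_distrr /=.
  move/eqP: uce; rewrite addrC addr_eq0 => /eqP ->.
  move/eqP: uc0; rewrite addrC addr_eq0 => /eqP ->.
  by rewrite !mulrN opprK; ring.
move=> u [t tw ut] Hu.
(* Scaling the other unknowns by [pi] lets the pivot equation be solved for the first one without
   division. *)
exists (fun k => if k is k'.+1 then pi * u k' else - \sum_(0 <= i < w) u i * c e0 i.+1).
  by exists t.+1; rewrite // mulf_neq0.
move=> e; rewrite big_nat_recl // -[RHS](Hu e) mulNr big_distrl /= addrC -sumrB.
by apply: eq_bigr => i _; ring.
Qed.

(** * Pencils of polynomials *)

(** [V] divides the top term, hence its coefficient [A m] by coprimality, and the size bound makes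
    that coefficient zero. The rest is divisible by [V], which lowers [m]. *)
Lemma binary_form_eq0_r (R : idomainType) (U V : {poly R}) (D m : nat) (A : nat -> {poly R}) :
  coprimep U V -> (D < size V)%N -> (forall k, (size (A k) <= D)%N) ->
  \sum_(0 <= k < m.+1) A k * U ^+ k * V ^+ (m - k) = 0 ->
  forall k, (k <= m)%N -> A k = 0.
Proof.
move=> cUV DV sA; have V0 : V != 0 by rewrite -size_poly_gt0 (leq_ltn_trans _ DV).
elim: m => [|m IH].
  by rewrite big_nat1 subnn !expr0 !mulr1 => A0 k; rewrite leqn0 => /eqP->.
rewrite big_nat_recr //= subnn expr0 mulr1.
set S := \sum_(0 <= k < m.+1) _.
have -> : S = (\sum_(0 <= k < m.+1) A k * U ^+ k * V ^+ (m - k)) * V.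
  rewrite big_distrl; apply: eq_big_nat => k /andP[_ km].
  by rewrite /= subSn // exprSr mulrA.
move=> H.
have A0 : A m.+1 = 0.
  have : V %| A m.+1 * U ^+ m.+1.
    rewrite (_ : A m.+1 * U ^+ m.+1 = - (\sum_(0 <= k < m.+1) A k * U ^+ k * V ^+ (m - k)) * V).
      by rewrite dvdp_mull.
    by apply/eqP; rewrite mulNr -addr_eq0 addrC H.
  rewrite Gauss_dvdpl; last by rewrite coprimep_sym coprimep_expl.
  move=> dV; apply/eqP; apply: contraT => An0.
  by have := leq_trans (dvdp_leq An0 dV) (sA _); rewrite leqNgt DV.
move: H; rewrite A0 mul0r addr0 => /eqP; rewrite mulf_eq0 (negPf V0) orbF => /eqP /IH H k.
by rewrite leq_eqVlt => /orP[/eqP->|/H].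
Qed.

Lemma binary_form_eq0 (R : idomainType) (U V : {poly R}) (D m : nat) (A : nat -> {poly R}) :
  coprimep U V -> (D < size U)%N || (D < size V)%N -> (forall k, (size (A k) <= D)%N) ->
  \sum_(0 <= k < m.+1) A k * U ^+ k * V ^+ (m - k) = 0 ->
  forall k, (k <= m)%N -> A k = 0.
Proof.
move=> cUV /orP[DU|DV] sA H k km; last exact: (binary_form_eq0_r cUV DV sA H).
rewrite -(subKn km); have cVU : coprimep V U by rewrite coprimep_sym.
apply: (binary_form_eq0_r (A := fun k => A (m - k)%N) (m := m) cVU DU); rewrite ?leq_subr //.
rewrite -[RHS]H [RHS]big_nat_rev /= add0n; apply: eq_big_nat => i /andP[_ im].
by rewrite subSS subKn // -mulrA [V ^+ _ * _]mulrC mulrA.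
Qed.

(* If C = gcd(F0 + c0 F1, G) is nontrivial and c <> c0, a common factor of F0 + c F1 and C divides
   F0, F1 and G, hence is trivial; so it remains to treat the smaller polynomial G / C. *)
Lemma coprimep_pencil (K : fieldType) (R : idomainType) (e : {rmorphism K -> R})
    (F0 F1 G : {poly R}) :
  coprimep F0 G -> G != 0 -> cofinite (fun c => coprimep (F0 + (e c)%:P * F1) G).
Proof.
have [k] := ubnP (size G); elim: k G => [//|k IHk] G /ltnSE sG cG G0.
have [H|/existsNP[c0 /negP Hc0]] :=
  pselect (forall c, coprimep (F0 + (e c)%:P * F1) G).
  by exists [::].
set C := gcdp (F0 + (e c0)%:P * F1) G in Hc0.
have dG : C %| G := dvdp_gcdr _ _.
have C0 : C != 0 by apply: contraNneq G0 => C0; move: dG; rewrite C0 dvd0p.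
have [a a0 GE] : exists2 a, a != 0 & exists Q, a *: G = Q * C.
  by have /Pdiv.Idomain.dvdpP[[a Q] /= a0 E] := dG; exists a => //; exists Q.
case: GE => Q GE.
have aG0 : a *: G != 0 by rewrite -size_poly_eq0 size_scale // size_poly_eq0.
have Q0 : Q != 0 by apply: contraNneq aG0 => Q0; rewrite GE Q0 mul0r.
have dQ : Q %| G by rewrite -(dvdpZr _ _ a0) GE dvdp_mulr.
have sC : size C != 1%N by rewrite -coprimep_def.
have sC1 : (1 < size C)%N by rewrite ltn_neqAle eq_sym sC size_poly_gt0.
have [||r Hr] := IHk Q _ _ Q0.
- have : size G = (size Q + size C).-1 by rewrite -size_mul // -GE size_scale.
  lia.
- exact: coprimep_dvdl cG.
exists (c0 :: r) => c; rewrite inE negb_or => /andP[cc0 /Hr cQ].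
rewrite -(coprimepZr _ _ a0) GE coprimepMr cQ /=.
apply/coprimepP => d dF dC.
have dF0 : d %| F0 + (e c0)%:P * F1 := dvdp_trans dC (dvdp_gcdl _ _).
have dF1 : d %| F1.
  have : d %| (F0 + (e c)%:P * F1) - (F0 + (e c0)%:P * F1) by rewrite dvdp_sub.
  rewrite opprD addrACA subrr add0r -mulrBl -polyCB -rmorphB /= mul_polyC dvdpZr //.
  by rewrite fmorph_eq0 subr_eq0.
move: dF0; rewrite dvdp_addl ?dvdp_mull // => dF0.
by move/coprimepP: cG => /(_ d dF0 (dvdp_trans dC dG)).
Qed.

(** * Bivariate monomials and evaluation *)

(* {poly {poly K}} is K[y][x]: the outer variable is x. For branches it is K[s][tau], outer tau. *)
Definition xymon (K : comNzRingType) (a b : nat) : {poly {poly K}} := ('X^b)%:P * 'X^a.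

(** Raising the two binomials to the powers [D] and [a] eliminates x, so a common divisor divides a
    polynomial in y alone. That polynomial is nonzero because the hypothesis says that (0,bo),
    (a,ba) and (D,bD) are not collinear. *)
Lemma coprimep_xymon (K : fieldType) (D a bD ba bo : nat) :
  (bD * a + bo * D != ba * D + bo * a)%N ->
  coprimep (xymon K a ba - xymon K 0 bo) (xymon K D bD - xymon K 0 bo).
Proof.
move=> ne; apply/coprimepP => d dF dG.
have dvd_pow A B n : d %| A - B -> d %| A ^+ n - B ^+ n.
  by move=> dAB; rewrite subrXX dvdp_mulr.
pose c : {poly K} := 'X^(bD * a + bo * D) - 'X^(ba * D + bo * a).
have c0 : c != 0.
  rewrite subr_eq0; apply: contraNneq ne => /(congr1 (fun p : {poly K} => size p)).
  by rewrite !size_polyXn => -[->].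
have : d %| c%:P.
  have -> : c%:P = ('X^(ba * D))%:P * (xymon K D bD ^+ a - xymon K 0 bo ^+ a)
                 - ('X^(bD * a))%:P * (xymon K a ba ^+ D - xymon K 0 bo ^+ D).
    rewrite /c /xymon expr0 !mulr1 !exprMn -!exprM polyCB !exprD !polyCM !exprM !polyC_exp.
    by rewrite -!exprM (mulnC D a); ring.
  by rewrite dvdp_sub // dvdp_mull // dvd_pow.
move=> dc; have d0 : d != 0.
  by apply: contraNneq c0 => d0; move: dc; rewrite d0 dvd0p polyC_eq0.
move/dvdp_leq: dc; rewrite polyC_eq0 => /(_ c0); rewrite size_polyC c0 => sd.
by rewrite -size_poly_eq1; move: sd; rewrite leq_eqVlt ltnS leqn0 size_poly_eq0 (negPf d0) orbF.
Qed.

Section Evaluation.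
Variables (K R : comNzRingType) (e : {rmorphism K -> R}) (x y : R).

Definition eval_y : {rmorphism {poly K} -> R} := horner_morph (fun c => mulrC y (e c)).
Definition eval_xy : {rmorphism {poly {poly K}} -> R} :=
  horner_morph (fun p => mulrC x (eval_y p)).

Lemma eval_xyC c : eval_xy c%:P%:P = e c.
Proof. by rewrite /= horner_morphC /= horner_morphC. Qed.

Lemma eval_xyY : eval_xy ('X)%:P = y.
Proof. by rewrite /= horner_morphC /= horner_morphX. Qed.

Lemma eval_xyX : eval_xy 'X = x.
Proof. by rewrite /= horner_morphX. Qed.

Lemma eval_xymon a b : eval_xy (xymon K a b) = x ^+ a * y ^+ b.
Proof. by rewrite /xymon polyC_exp rmorphM !rmorphXn eval_xyX eval_xyY mulrC. Qed.

End Evaluation.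

Lemma bipoly_morph_ext (K R : comNzRingType) (f g : {rmorphism {poly {poly K}} -> R}) :
  (forall c, f c%:P%:P = g c%:P%:P) -> f ('X)%:P = g ('X)%:P -> f 'X = g 'X -> f =1 g.
Proof.
move=> fgC fgY fgX; elim/poly_ind => [|p c IHp]; first by rewrite !rmorph0.
rewrite !rmorphD !rmorphM IHp fgX; congr (_ + _).
elim/poly_ind: c => [|q c IHq]; first by rewrite !rmorph0.
by rewrite polyCD polyCM !rmorphD !rmorphM IHq fgY fgC.
Qed.

Lemma eval_xy_morph (K R S : comNzRingType) (e : {rmorphism K -> R}) (e' : {rmorphism K -> S})
   (h : {rmorphism R -> S}) (x y : R) (p : {poly {poly K}}) :
  (forall c, h (e c) = e' c) -> h (eval_xy e x y p) = eval_xy e' (h x) (h y) p.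
Proof.
move=> he; apply: (bipoly_morph_ext (f := h \o eval_xy e x y)) => [c||].
- by rewrite [LHS](congr1 h (eval_xyC _ _ _ _)) eval_xyC he.
- by rewrite [LHS](congr1 h (eval_xyY _ _ _)) eval_xyY.
- by rewrite [LHS](congr1 h (eval_xyX _ _ _)) eval_xyX.
Qed.

Definition emb2 (K : comNzRingType) : {rmorphism K -> {poly {poly K}}} := polyC \o polyC.

(** The curves for varying s dominate the plane: x is nonconstant in tau and free of s, while y has
    degree 1 in s. With s as outer variable the substitution is a composition of x -> [u] on
    coefficients and y -> [w], both injective. *)
Lemma arc_inj (K : fieldType) (k g q : nat) (H : {poly {poly K}}) : (0 < k)%N ->
  eval_xy (emb2 K) ((1 + 'X) ^+ k) ((1 + ('X)%:P * 'X^q) * (1 + 'X) ^+ g) H = 0 -> H = 0.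
Proof.
move=> k0 /(congr1 (@swapXY K)) H0.
pose u : {poly K} := (1 + 'X) ^+ k.
pose w : {poly {poly K}} := ('X * ('X^q)%:P + 1) * ((1 + 'X) ^+ g)%:P.
have sX1 : size (1 + 'X : {poly K}) = 2%N by rewrite addrC size_XaddC.
have su : (1 < size u)%N.
  by rewrite -(prednK (n := size u)) ?size_exp ?sX1 ?mul1n // size_poly_gt0 expf_neq0 // -size_poly_eq0 sX1.
have sw : size w = 2%N.
  have g0 : (1 + 'X : {poly K}) ^+ g != 0 by rewrite expf_neq0 // -size_poly_eq0 sX1.
  have q0 : ('X : {poly K}) ^+ q != 0 by rewrite expf_neq0 ?polyX_eq0.
  have -> : w = (1 + 'X) ^+ g *: (('X^q)%:P * 'X + 1%:P).
    by rewrite -mul_polyC /w polyC1 mulrC ['X * _]mulrC.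
  by rewrite size_scale // size_MXaddC polyC_eq0 (negPf q0) size_polyC q0.
have sP : swapXY (1 + 'X : {poly {poly K}}) = (1 + 'X)%:P.
  by rewrite rmorphD rmorph1 /= swapXY_X polyCD polyC1.
have sE : swapXY (eval_xy (emb2 K) ((1 + 'X) ^+ k) ((1 + ('X)%:P * 'X^q) * (1 + 'X) ^+ g) H)
    = (map_poly (comp_poly u) (swapXY H)) \Po w.
  apply: (bipoly_morph_ext (f := @swapXY K \o eval_xy _ _ _)
     (g := comp_poly w \o map_poly (comp_poly u) \o @swapXY K)) => [c||].
  - rewrite [LHS](congr1 (@swapXY K) (eval_xyC _ _ _ _)) /=.
    by rewrite swapXY_polyC map_polyC /= map_polyC /= !comp_polyC.
  - rewrite [LHS](congr1 (@swapXY K) (eval_xyY _ _ _)) /= swapXY_Y map_polyX comp_polyX.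
    rewrite !rmorphM /= rmorphD rmorph1 rmorphM !rmorphXn /= sP swapXY_Y swapXY_X /w [_ + 1]addrC.
    by rewrite !polyC_exp.
  - rewrite [LHS](congr1 (@swapXY K) (eval_xyX _ _ _)) /= swapXY_X rmorphXn /= sP /u.
    by rewrite map_polyC /= comp_polyX comp_polyC polyC_exp.
move: H0; rewrite rmorph0 => /(etrans (esym sE)) /eqP; rewrite comp_poly2_eq0 //.
move/eqP => H0; apply: (can_inj (@swapXYK K)); rewrite [RHS]rmorph0.
apply: (@map_inj_poly _ _ (comp_poly u)); rewrite ?map_poly0 //; last exact: comp_poly0.
by move=> a b /eqP; rewrite -subr_eq0 -comp_polyB comp_poly_eq0 // subr_eq0 => /eqP.
Qed.

(** * Branches through (1,1) *)

(** [Psi] is chosen before [V]: the remainder is a polynomial function of [V], as the iteration that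
    builds the branch requires. *)
Lemma taylor2 (R : comNzRingType) (T : R) (a b : nat) :
  exists Psi : {poly R}, forall V,
    (1 + T) ^+ a * (1 + V * T) ^+ b = 1 + (a%:R + b%:R * V) * T + T ^+ 2 * Psi.[V].
Proof.
elim: b => [|b [Psi H]]; first elim: a => [|a [Psi H]].
- by exists 0 => V; rewrite !expr0 horner0; ring.
- exists ((1 + T)%:P * Psi + a%:R%:P) => V.
  have {}H := H V; rewrite expr0 in H *.
  by rewrite hornerD hornerM !hornerC exprS -mulrA H -natr1; ring.
exists ((1 + 'X * T%:P) * Psi + 'X * (a%:R%:P + b%:R%:P * 'X)) => V.
rewrite hornerD !hornerM !hornerD !hornerM !hornerC !hornerX.
rewrite exprS mulrCA H -natr1; ring.
Qed.

(** Congruence to 0 modulo tau^N. Branches are handled through such truncations instead of power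
    series. *)
Definition tau_small (R : comNzRingType) (N : nat) (z : {poly R}) := exists Q, z = Q * 'X^N.

Section TauSmall.
Variables (R : comNzRingType) (N : nat).
Implicit Types z : {poly R}.

Lemma tau_smallD z1 z2 : tau_small N z1 -> tau_small N z2 -> tau_small N (z1 + z2).
Proof. by move=> [Q ->] [Q' ->]; exists (Q + Q'); rewrite mulrDl. Qed.

Lemma tau_smallM z1 z2 : tau_small N z2 -> tau_small N (z1 * z2).
Proof. by move=> [Q ->]; exists (z1 * Q); rewrite mulrA. Qed.

Lemma tau_small_sum (J : eqType) (r : seq J) (F : J -> {poly R}) :
  (forall j, j \in r -> tau_small N (F j)) -> tau_small N (\sum_(j <- r) F j).
Proof.
move=> HF; rewrite big_seq; elim/big_ind: _ => //; first by exists 0; rewrite mul0r.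
exact: tau_smallD.
Qed.

Lemma tau_smallP z : tau_small N z <-> forall i, (i < N)%N -> z`_i = 0.
Proof.
split=> [[Q ->] i iN|H]; first by rewrite coefMXn iN.
exists (drop_poly N z); rewrite -{1}(poly_take_drop N z) (_ : take_poly N z = 0) ?add0r //.
by apply/polyP => i; rewrite coef_take_poly coef0; case: ifP => // /H.
Qed.

Lemma tau_smallX z1 z2 k : tau_small N (z1 - z2) -> tau_small N (z1 ^+ k - z2 ^+ k).
Proof. by move=> H; rewrite subrXX mulrC; apply: tau_smallM. Qed.

End TauSmall.

Lemma tau_small_factor (K : fieldType) (N : nat) (p q : {poly K}) :
  q`_0 != 0 -> tau_small N (p * q) -> tau_small N p.
Proof.
move=> q0 [Q E].
have : 'X^N %| p * q by rewrite E dvdp_mull.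
rewrite Gauss_dvdpl ?coprimep_expl //; first by move/dvdpP.
by rewrite coprimep_sym coprimepX rootE horner_coef0.
Qed.

Definition bipoly (K : comNzRingType) (J : Type) (r : seq J) (a b : J -> nat) (f : J -> K) :
    {poly {poly K}} :=
  \sum_(l <- r) (f l)%:P%:P * xymon K (a l) (b l).

Lemma eval_bipoly (K R : comNzRingType) (e : {rmorphism K -> R}) (x y : R)
    (J : Type) (r : seq J) (a b : J -> nat) (f : J -> K) :
  eval_xy e x y (bipoly r a b f) = \sum_(l <- r) e (f l) * (x ^+ a l * y ^+ b l).
Proof.
rewrite rmorph_sum; apply: eq_bigr => l _.
by rewrite rmorphM eval_xyC eval_xymon.
Qed.

(** Weighted parametrization starting at (1,1). If k a + ga b = r + q a' and q is a power of the
    characteristic (or 1), then x^a y^b becomes (1+tau)^r (1+tau^q)^a' (1+V tau^q)^b: up to a common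
    unit, the exponent a is replaced by a' and tau by tau^q. *)
Definition arcx (K : comNzRingType) (k : nat) : {poly {poly K}} := (1 + 'X) ^+ k.
Definition arcy (K : comNzRingType) (q g : nat) (V : {poly {poly K}}) : {poly {poly K}} :=
  (1 + V * 'X^q) * (1 + 'X) ^+ g.

Section Arc.
Variables (K : fieldType) (J : eqType) (I : seq J) (a b a' : J -> nat) (f g : J -> K).
Variables (k ga r q : nat).
Hypothesis aE : forall l, l \in I -> (k * a l + ga * b l = r + q * a' l)%N.
Hypothesis q_gt0 : (0 < q)%N.
Hypothesis frob : (1 + 'X) ^+ q = 1 + 'X^q :> {poly {poly K}}.
Hypothesis f_sum : \sum_(l <- I) f l = 0.
Hypothesis g_sum : \sum_(l <- I) g l = 0.
Hypothesis f_suma : \sum_(l <- I) f l * (a' l)%:R = 0.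
Hypothesis f_sumb : \sum_(l <- I) f l * (b l)%:R = 1.
Hypothesis g_suma : \sum_(l <- I) g l * (a' l)%:R = -1.
Hypothesis g_sumb : \sum_(l <- I) g l * (b l)%:R = 0.

Local Notation ev V := (eval_xy (emb2 K) (arcx K k) (arcy q ga V)).
Local Notation s := (('X)%:P : {poly {poly K}}).
Local Notation F := (bipoly I a b f).
Local Notation G := (bipoly I a b g).

(** With T = tau^q and h = f + s g, the expansion starts with the sum of h plus T times (sum of h a'
    + V times sum of h b). The moment hypotheses reduce this to (V - s) T, which gives the branch
    its initial value V = s. *)
Lemma arc_pencil : exists Psi : {poly {poly {poly K}}}, forall V,
  ev V F + s * ev V G = (1 + 'X) ^+ r * 'X^q * (V - s + 'X^q * Psi.[V]).
Proof.
have /choice[Psi HPsi] := fun l => taylor2 ('X^q : {poly {poly K}}) (a' l) (b l).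
pose e := emb2 K; pose h l : {poly {poly K}} := e (f l) + s * e (g l).
exists (\sum_(l <- I) (h l)%:P * Psi l) => V.
have term l : l \in I -> arcx K k ^+ a l * arcy q ga V ^+ b l =
   (1 + 'X) ^+ r * (1 + ((a' l)%:R + (b l)%:R * V) * 'X^q + 'X^q ^+ 2 * (Psi l).[V]).
  move=> lI; rewrite -HPsi -frob -exprM /arcx /arcy exprMn mulrCA -!exprM mulrC -exprD.
  by rewrite (aE lI) exprD -!mulrA; ring.
rewrite !eval_bipoly big_distrr -big_split /=.
transitivity ((1 + 'X) ^+ r * \sum_(l <- I)
    h l * (1 + ((a' l)%:R + (b l)%:R * V) * 'X^q + 'X^q ^+ 2 * (Psi l).[V])).
  rewrite big_distrr !big_seq; apply: eq_bigr => l lI /=; rewrite term // /h; ring.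
rewrite -mulrA; congr (_ * _).
have hsum (w : J -> K) : \sum_(l <- I) h l * e (w l)
    = e (\sum_(l <- I) f l * w l) + s * e (\sum_(l <- I) g l * w l).
  rewrite !rmorph_sum big_distrr -big_split; apply: eq_bigr => l _ /=.
  by rewrite mulrDl -mulrA -!rmorphM.
have sumP : \sum_(l <- I) h l = 0.
  transitivity (\sum_(l <- I) h l * e 1).
    by apply: eq_bigr => l _; rewrite rmorph1 mulr1.
  rewrite (hsum (fun=> 1)); under eq_bigr do rewrite mulr1.
  under [X in _ + _ * e X]eq_bigr do rewrite mulr1.
  by rewrite f_sum g_sum rmorph0 mulr0 addr0.
have sumA : \sum_(l <- I) h l * (a' l)%:R = - s.
  under eq_bigr do rewrite -(rmorph_nat e).
  by rewrite (hsum (fun l => (a' l)%:R)) f_suma g_suma rmorph0 add0r rmorphN1 mulrN1.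
have sumB : \sum_(l <- I) h l * (b l)%:R = 1.
  under eq_bigr do rewrite -(rmorph_nat e).
  by rewrite (hsum (fun l => (b l)%:R)) f_sumb g_sumb rmorph0 mulr0 addr0 rmorph1.
transitivity (\sum_(l <- I) h l + (\sum_(l <- I) h l * (a' l)%:R) * 'X^q
   + (\sum_(l <- I) h l * (b l)%:R) * V * 'X^q + 'X^q ^+ 2 * \sum_(l <- I) h l * (Psi l).[V]).
  rewrite !big_distrl big_distrr -!big_split; apply: eq_bigr => l _ /=; ring.
rewrite sumP sumA sumB horner_sum; under [in RHS]eq_bigr do rewrite hornerM hornerC.
ring.
Qed.

(* The branch is the limit of the fixed-point iteration V = s - tau^q Psi(V). *)
Lemma arc_exists : exists V : nat -> {poly {poly K}}, forall N,
  tau_small 1 (V N - s) /\ tau_small N (ev (V N) F + s * ev (V N) G).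
Proof.
have [Psi HPsi] := arc_pencil.
pose step V := s - 'X^q * Psi.[V]; exists (fun N => iter N step s) => N; split.
  case: N => [|N] /=; first by exists 0; rewrite subrr mul0r.
  exists (- 'X^(q.-1) * Psi.[iter N step s]).
  by rewrite /step addrC addKr mulNr mulNr -mulrA [Psi.[_] * _]mulrC mulrA -exprD addn1 prednK.
rewrite HPsi -mulrA; apply: tau_smallM; apply: tau_smallM.
elim: N => [|N IH]; first by exists (s - s + 'X^q * Psi.[s]); rewrite mulr1.
set V := iter N step s in IH *; rewrite /= -/V.
have [Q HQ] : exists Q, Psi - Psi.[V]%:P = Q * ('X - V%:P).
  by apply/factor_theorem; rewrite rootE hornerD hornerN hornerC subrr.
have HQ' : Psi.[step V] - Psi.[V] = Q.[step V] * (step V - V).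
  by have := congr1 (fun p => p.[step V]) HQ; rewrite hornerD hornerN hornerC hornerM hornerXsubC.
(* The iteration contracts: [step V - V] is minus the old error, so the new error is the old one
   times a multiple of tau^q. One factor tau per step is enough. *)
have -> : step V - s + 'X^q * Psi.[step V]
    = - ('X^(q.-1) * Q.[step V]) * ((V - s + 'X^q * Psi.[V]) * 'X).
  transitivity ('X^q * (Psi.[step V] - Psi.[V])); first by rewrite /step; ring.
  rewrite HQ' -{1}(prednK q_gt0) exprSr /step; ring.
apply: tau_smallM; case: IH => Q' ->; exists Q'; by rewrite -mulrA -exprSr.
Qed.

End Arc.

Lemma coef_xymon (K : comNzRingType) (c : K) (a b i j : nat) :
  (c%:P%:P * xymon K a b)`_i`_j = c * ((i == a) && (j == b))%:R.
Proof.
rewrite coefCM /xymon coefCM coefXn coefCM -mulnb natrM [RHS]mulrCA mulrA.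
by case: (i == a); rewrite ?mulr1 ?mulr0 ?coef0 ?mulr0 ?mul0r ?mul1r // coefXn.
Qed.

Section Grid.
Variables (K : comNzRingType) (D E : nat).

(** Identifies the polynomials of x-degree below [D] and y-degree below [E] with vectors of length
    [D * E], so that vanishing along a branch becomes a linear system. *)
Definition grid (u : nat -> K) : {poly {poly K}} :=
  \sum_(0 <= t < D * E) (u t)%:P%:P * xymon K (t %/ E) (t %% E).

Lemma coef_grid u i j : (i < D)%N -> (j < E)%N -> (grid u)`_i`_j = u (i * E + j)%N.
Proof.
move=> iD jE; rewrite /grid !coef_sum.
have tDE : (i * E + j < D * E)%N.
  by rewrite (leq_trans (n := i.+1 * E)) ?leq_mul2r ?iD ?orbT // mulSn addnC ltn_add2r.
rewrite (bigD1_seq (i * E + j)%N) ?mem_index_iota ?iota_uniq //= coef_xymon.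
have E0 : (0 < E)%N by apply: leq_ltn_trans jE.
rewrite divnMDl // divn_small // modnMDl modn_small // addn0 !eqxx mulr1.
rewrite big1_seq ?addr0 // => t /andP[ti _]; rewrite coef_xymon.
case: eqP => [it|]; last by rewrite mulr0.
by case: eqP => [jt|]; rewrite /= ?mulr0 //; rewrite it jt -divn_eq eqxx in ti.
Qed.

Lemma size_grid u : (size (grid u) <= D)%N.
Proof.
apply: (leq_trans (size_sum _ _ _)); apply/bigmax_leqP_seq => t.
rewrite mem_index_iota => /andP[_ tDE] _.
rewrite /xymon mulrA -polyCM mul_polyC (leq_trans (size_scale_leq _ _)) // size_polyXn.
by rewrite ltn_divLR // lt0n; apply: contraTneq tDE => ->; rewrite muln0.
Qed.

Lemma gridE (A : {poly {poly K}}) : (size A <= D)%N -> (sizeY A <= E)%N ->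
  A = grid (fun t => A`_(t %/ E)`_(t %% E)).
Proof.
move=> sA sYA; apply/polyP => i; apply/polyP => j.
have [iD|Di] := ltnP i D; last first.
  by rewrite (nth_default 0 (leq_trans sA Di)) (nth_default 0 (leq_trans (size_grid _) Di)).
have [jE|Ej] := ltnP j E.
  rewrite coef_grid // divnMDl ?modnMDl ?modn_small ?divn_small ?addn0 //.
  exact: leq_ltn_trans jE.
rewrite (nth_default 0 (leq_trans (leq_trans (max_size_coefXY A i) sYA) Ej)).
rewrite /grid !coef_sum big1_seq // => t; rewrite mem_index_iota => /andP[_ /andP[_ tDE]].
rewrite coef_xymon [j == _](_ : _ = false) ?andbF ?mulr0 //.
apply: gtn_eqF; apply: leq_trans Ej; rewrite ltn_mod lt0n.
by apply: contraTneq tDE => ->; rewrite muln0.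
Qed.

Lemma eval_grid (R : comNzRingType) (e : {rmorphism K -> R}) (x y : R) u :
  eval_xy e x y (grid u) = \sum_(0 <= t < D * E) e (u t) * (x ^+ (t %/ E) * y ^+ (t %% E)).
Proof. by rewrite rmorph_sum; apply: eq_bigr => t _; rewrite rmorphM eval_xyC eval_xymon. Qed.

End Grid.

Lemma sizeY_factor (R : idomainType) (A B : {poly {poly R}}) :
  A * B != 0 -> (sizeY A <= sizeY (A * B))%N.
Proof.
rewrite mulf_eq0 negb_or => /andP[A0 B0].
rewrite !sizeYE rmorphM /= size_mul ?swapXY_eq0 //.
have : (0 < size (swapXY B))%N by rewrite size_poly_gt0 swapXY_eq0.
case: (size (swapXY B)) => // n _; by rewrite addnS leq_addr.
Qed.

(* Vanishing on all branches forces the vanishing of the lowest tau-coefficient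
   h(s) of H on the initial curve V = s, since V = s modulo tau and s is transcendental. *)
Lemma vanish_on_arcs (K : fieldType) (k q ga : nat) (V : nat -> {poly {poly K}})
    (H : {poly {poly K}}) : (0 < k)%N ->
  (forall N, tau_small 1 (V N - ('X)%:P)) ->
  (forall N, tau_small N (eval_xy (emb2 K) (arcx K k) (arcy q ga (V N)) H)) -> H = 0.
Proof.
move=> k0 VX HV; apply: (arc_inj (q := q) (g := ga) k0); rewrite -/(arcx K k) -/(arcy q ga 'Y).
set Z := eval_xy _ _ _ H; apply/eqP; apply: contraT => Z0.
have [e Ze He] : exists2 e, Z`_e != 0 & forall i, (i < e)%N -> Z`_i = 0.
  have ex : exists e, Z`_e != 0 by exists (size Z).-1; rewrite -lead_coefE lead_coef_eq0.
  exists (ex_minn ex); first by case: ex_minnP.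
  case: ex_minnP => m _ Hm i im; apply/eqP; apply: contraTT im => /Hm; by rewrite -leqNgt.
have [Z1 ZE] : tau_small e Z by apply/tau_smallP.
(* [theta] fixes tau and replaces s by [V e.+1]; it carries the initial curve to the branch and
   preserves constant terms in tau. *)
pose theta := eval_xy (emb2 K) 'X (V e.+1).
have thetaZ : theta Z = eval_xy (emb2 K) (arcx K k) (arcy q ga (V e.+1)) H.
  rewrite /Z /theta (eval_xy_morph (e' := emb2 K)); last exact: eval_xyC.
  congr (eval_xy _ _ _ H).
    by rewrite /arcx rmorphXn rmorphD rmorph1 eval_xyX.
  by rewrite /arcy rmorphM rmorphXn !rmorphD rmorph1 rmorphM rmorphXn eval_xyX eval_xyY.
have /tau_smallP/(_ e (ltnSn _)) := HV e.+1; rewrite -thetaZ ZE rmorphM rmorphXn eval_xyX.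
rewrite coefMXn ltnn subnn => th0.
have := Ze; rewrite ZE coefMXn ltnn subnn.
suff -> : Z1`_0 = (theta Z1)`_0 by rewrite th0 eqxx.
rewrite -!horner_coef0.
have V0 : (V e.+1).[0] = 'X.
  have [Q /(congr1 (fun p => p.[0]))] := VX e.+1.
  by rewrite expr1 hornerD hornerN hornerC hornerM hornerX mulr0 => /eqP; rewrite subr_eq0 => /eqP.
apply: (bipoly_morph_ext (f := horner_eval 0) (g := horner_eval 0 \o theta)) => [c||].
- by rewrite [RHS](congr1 (horner_eval 0) (eval_xyC _ _ _ _)).
- by rewrite [RHS](congr1 (horner_eval 0) (eval_xyY _ _ _)) [RHS]V0 [LHS]hornerC.
- by rewrite [RHS](congr1 (horner_eval 0) (eval_xyX _ _ _)).
Qed.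

(** * Irreducible members of a pencil *)

(** Every branch starts at (1,1). Hence a factor that is nonzero there is a unit along the branch,
    and the other factor inherits all the vanishing of the product. *)
Lemma specialize_arc (K : fieldType) (k q ga : nat) (V : {poly {poly K}}) (s : K)
    (B : {poly {poly K}}) : (0 < q)%N ->
  (map_poly (horner_eval s) (eval_xy (emb2 K) (arcx K k) (arcy q ga V) B))`_0 = B.[1].[1].
Proof.
move=> q0; rewrite -horner_coef0.
have at0 (W : {poly {poly K}}) :
    (map_poly (horner_eval s) W).[0] = W.[0].[s].
  by rewrite !horner_coef0 coef_map /= /horner_eval.
apply: (bipoly_morph_ext (g := horner_eval 1 \o horner_eval 1)
  (f := horner_eval 0 \o map_poly (horner_eval s) \o eval_xy _ _ _)) => [c||].
- by rewrite /horner_eval [LHS]at0 eval_xyC /= /horner_eval !hornerC.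
- rewrite /horner_eval [LHS]at0 eval_xyY /= /horner_eval /arcy !hornerC hornerM hornerD !horner_exp.
  rewrite ?hornerM hornerXn expr0n eqn0Ngt q0 mulr0 addr0 [(1 + 'X).[0]]hornerD hornerX addr0.
  by rewrite -polyC1 !hornerC !expr1n -!polyC1 !hornerC mulr1 hornerX.
- rewrite /horner_eval [LHS]at0 eval_xyX /= /horner_eval /arcx horner_exp hornerD !hornerX hornerC addr0.
  by rewrite expr1n !hornerC.
Qed.

(** Used with P = -F and Q = G: along the branch P agrees with s Q, so the second sum is small and
    the form reduces to Q^m times a polynomial in s. This is the substitution s = -F/G with
    denominators cleared. *)
Lemma binary_form_split (R : comNzRingType) (x : nat -> R) (P Q s : R) (m : nat) :
  \sum_(0 <= j < m.+1) x j * P ^+ j * Q ^+ (m - j)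
  = Q ^+ m * (\sum_(0 <= j < m.+1) s ^+ j * x j)
    + \sum_(0 <= j < m.+1) (x j * Q ^+ (m - j)) * (P ^+ j - (s * Q) ^+ j).
Proof.
rewrite big_distrr -big_split; apply: eq_big_nat => j /andP[_ jm] /=.
have -> : Q ^+ m = Q ^+ (m - j) * Q ^+ j by rewrite -exprD subnK.
by rewrite exprMn; ring.
Qed.

Lemma polyC_expand (K : fieldType) (p : {poly K}) (m : nat) : (size p <= m)%N ->
  p%:P = \sum_(0 <= j < m) ('X)%:P ^+ j * (p`_j)%:P%:P :> {poly {poly K}}.
Proof.
move=> pm; transitivity (\sum_(0 <= j < m) p`_j *: 'X^j)%:P.
  congr _%:P; apply/polyP => j; rewrite coef_sum big_mkord.
  under eq_bigr do rewrite coefZ coefXn.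
  have [jm|mj] := ltnP j m.
    rewrite (bigD1 (Ordinal jm)) //= eqxx mulr1 big1 ?addr0 // => i ij.
    by rewrite eq_sym (negPf (ij : i != j :> nat)) mulr0.
  rewrite nth_default ?(leq_trans pm) // big1 // => i _.
  by rewrite gtn_eqF ?mulr0 // (leq_trans (ltn_ord i)).
rewrite rmorph_sum; apply: eq_bigr => j _ /=.
by rewrite -mul_polyC polyCM polyC_exp mulrC.
Qed.

Section Pencil.
Variables (K : closedFieldType) (J : eqType) (I : seq J) (a b a' : J -> nat) (f g : J -> K).
Variables (k ga r q D : nat).
Hypothesis k_gt0 : (0 < k)%N.
Hypothesis aE : forall l, l \in I -> (k * a l + ga * b l = r + q * a' l)%N.
Hypothesis q_gt0 : (0 < q)%N.
Hypothesis frob : (1 + 'X) ^+ q = 1 + 'X^q :> {poly {poly K}}.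
Hypothesis f_sum : \sum_(l <- I) f l = 0.
Hypothesis g_sum : \sum_(l <- I) g l = 0.
Hypothesis f_suma : \sum_(l <- I) f l * (a' l)%:R = 0.
Hypothesis f_sumb : \sum_(l <- I) f l * (b l)%:R = 1.
Hypothesis g_suma : \sum_(l <- I) g l * (a' l)%:R = -1.
Hypothesis g_sumb : \sum_(l <- I) g l * (b l)%:R = 0.

Local Notation F := (bipoly I a b f).
Local Notation G := (bipoly I a b g).
Hypothesis coFG : coprimep F G.
Hypothesis sizeFG : (D < size F)%N || (D < size G)%N.
Hypothesis sizeF : (size F <= D.+1)%N.
Hypothesis sizeG : (size G <= D.+1)%N.

Lemma bipoly_horner1 (h : J -> K) : (bipoly I a b h).[1] = \sum_(l <- I) (h l)%:P * 'X^(b l).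
Proof.
rewrite horner_sum; apply: eq_bigr => l _.
by rewrite /xymon hornerM hornerC hornerM hornerC hornerXn expr1n mulr1.
Qed.

Lemma bipoly_deriv11 (h : J -> K) :
  ((bipoly I a b h).[1]^`()).[1] = \sum_(l <- I) h l * (b l)%:R.
Proof.
rewrite bipoly_horner1 raddf_sum horner_sum; apply: eq_bigr => l _.
by rewrite /= mul_polyC derivZ hornerZ derivXn hornerMn hornerXn expr1n.
Qed.

(* Every member has y-derivative 1 at (1,1), so its factors cannot both vanish there. *)
Lemma pencil_smooth (s : K) (A B : {poly {poly K}}) :
  A * B = F + s%:P%:P * G -> (A.[1].[1] != 0) || (B.[1].[1] != 0).
Proof.
move=> AB; apply: contraT; rewrite negb_or !negbK => /andP[/eqP A0 /eqP B0].
have := congr1 (fun P : {poly {poly K}} => (P.[1]^`()).[1]) AB.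
rewrite hornerM derivM hornerD !hornerM A0 B0 mulr0 mul0r addr0.
rewrite hornerD derivD hornerD bipoly_deriv11 f_sumb hornerM hornerC mul_polyC derivZ hornerZ.
by rewrite bipoly_deriv11 g_sumb mulr0 addr0 => /esym/eqP; rewrite oner_eq0.
Qed.

Lemma pencil_irreducible (bad : seq K) : exists2 s, s \notin bad &
  forall A B : {poly {poly K}}, A * B = F + s%:P%:P * G -> (size A <= 1)%N || (size B <= 1)%N.
Proof.
apply: contrapT => Hbad.
(* [B] is the factor that is nonzero at (1,1). Having positive x-degree, it leaves [A] with size at
   most [D], strictly below the larger of the sizes of F and G; the final coprimality argument needs
   this drop. *)
have red s : s \notin bad -> exists A B : {poly {poly K}},
    [/\ A * B = F + s%:P%:P * G, (1 < size B)%N, A != 0 & B.[1].[1] != 0].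
  move=> sbad; apply: contrapT => nex; apply: Hbad; exists s => // A B AB.
  rewrite leqNgt [X in _ || X]leqNgt -negb_and; apply/negP => /andP[sA sB]; apply: nex.
  have A0 : A != 0 by rewrite -size_poly_gt0 ltnW.
  have B0 : B != 0 by rewrite -size_poly_gt0 ltnW.
  by have /orP[] := pencil_smooth AB => H; [exists B, A | exists A, B]; split; rewrite // mulrC.
have [V HV] := arc_exists aE q_gt0 frob f_sum g_sum f_suma f_sumb g_suma g_sumb.
pose ev N := eval_xy (emb2 K) (arcx K k) (arcy q ga (V N)).
pose E := maxn (sizeY F) (sizeY G).
(* The equation indexed by (N, e) with e < N says that the coefficient of tau^e vanishes along the
   N-th approximation of the branch; the other indices give trivial equations. *)
pose c (Ne : nat * nat) t : {poly K} := if (Ne.2 < Ne.1)%N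
  then (ev Ne.1 (xymon K (t %/ E) (t %% E)))`_Ne.2 else 0.
have [|u [t0 t0w ut0] Hu] := @pencil_kernel K _ (D * E) c.
  move=> bad'.
  have [s] : exists s : K, s \notin bad ++ bad' by apply: (@cofinite_ex K); exists (bad ++ bad').
  rewrite mem_cat negb_or => /andP[sbad sbad']; exists s => //.
  have [A [B [AB sB A0 B1]]] := red s sbad.
  have P0 : A * B != 0 by rewrite mulf_neq0 // -size_poly_gt0 ltnW.
  have sA : (size A <= D)%N.
    have B0 : B != 0 by rewrite -size_poly_gt0 ltnW.
    have : (size (A * B)%R <= D.+1)%N.
      rewrite AB (leq_trans (size_polyD _ _)) // geq_max sizeF mul_polyC.
      exact: leq_trans (size_scale_leq _ _) sizeG.
    rewrite size_mul //; case: (size B) sB => [|[|n]] // _.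
    by rewrite !addnS /= ltnS => /(leq_trans (leq_addr _ _)).
  have sYA : (sizeY A <= E)%N.
    apply: leq_trans (sizeY_factor P0) _; rewrite AB /E !sizeYE rmorphD rmorphM /=.
    rewrite swapXY_polyC map_polyC mul_polyC (leq_trans (size_polyD _ _)) // geq_max leq_maxl.
    by rewrite (leq_trans (size_scale_leq _ _)) // leq_maxr.
  pose u t := A`_(t %/ E)`_(t %% E).
  have AE : A = grid D E u := gridE sA sYA.
  exists u.
    apply: contrapT => nz; move: A0; rewrite AE /grid big_nat big1 ?eqxx // => t /andP[_ tw].
    have -> : u t = 0 by apply/eqP; apply: contrapT => /negP ut; apply: nz; exists t.
    by rewrite mul0r.
  move=> [N e]; rewrite /c /=; case: (ltnP e N) => eN; last first.
    by rewrite big1 // => i _; rewrite horner0 mulr0.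
  pose sp := map_poly (horner_eval s) : {poly {poly K}} -> {poly K}.
  have -> : \sum_(0 <= t < D * E) u t * ((ev N (xymon K (t %/ E) (t %% E)))`_e).[s]
      = (sp (ev N A))`_e.
    rewrite [in RHS]AE /ev eval_grid /sp rmorph_sum coef_sum; apply: eq_bigr => t _ /=.
    by rewrite eval_xymon rmorphM /= map_polyC coefCM coef_map /= /horner_eval hornerC.
  have : tau_small N (sp (ev N A)).
    apply: (@tau_small_factor _ _ _ (sp (ev N B))).
      by rewrite /sp /ev specialize_arc.
    have [_ [Q HQ]] := HV N; exists (sp Q).
    have -> : sp (ev N A) * sp (ev N B) = sp (ev N F + ('X)%:P * ev N G).
      rewrite /sp -rmorphM /= -rmorphM AB !rmorphD !rmorphM /=; congr (_ + _ * _).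
      by rewrite /ev eval_xyC /= !map_polyC /= /horner_eval hornerX hornerC.
    by rewrite HQ /sp rmorphM /= map_polyXn.
  by move/tau_smallP => /(_ e eN).
(* [m] bounds the s-degree of the generic solution, [A j] is its coefficient of s^j, and [H] is the
   solution at s = -F/G multiplied by G^m. *)
pose m := \max_(i < D * E) size (u i).
have um t : (t < D * E)%N -> (size (u t) <= m)%N.
  by move=> tw; rewrite (leq_bigmax_cond (Ordinal tw)).
pose A j := grid D E (fun t => (u t)`_j).
pose H := \sum_(0 <= j < m.+1) A j * (- F) ^+ j * G ^+ (m - j).
have H0 : H = 0.
  apply: (vanish_on_arcs (q := q) (ga := ga) (V := V) k_gt0) => N; first by have [] := HV N.
  rewrite -/(ev N).
  have [_ HFG] := HV N; rewrite -/(ev N) in HFG.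
  pose Z := \sum_(0 <= j < m.+1) ('X)%:P ^+ j * ev N (A j).
  have Zsmall : tau_small N Z.
    apply/tau_smallP => e eN.
    have -> : Z = \sum_(0 <= t < D * E) (u t)%:P * ev N (xymon K (t %/ E) (t %% E)).
      rewrite /Z; under eq_bigr do rewrite /A /ev eval_grid big_distrr.
      rewrite exchange_big; apply: eq_big_nat => t /andP[_ tw] /=.
      rewrite /ev eval_xymon; set w := arcx _ _ ^+ _ * _; under eq_bigr do rewrite mulrA.
      rewrite -big_distrl; congr (_ * _).
      by rewrite [RHS](polyC_expand (leqW (um t tw))).
    rewrite coef_sum -[RHS](Hu (N, e)); apply: eq_bigr => t _.
    by rewrite coefCM /c /= eN.
  have -> : ev N H = \sum_(0 <= j < m.+1) ev N (A j) * (- ev N F) ^+ j * ev N G ^+ (m - j).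
    rewrite /H rmorph_sum; apply: eq_bigr => j _.
    by rewrite !rmorphM !rmorphXn rmorphN.
  rewrite (binary_form_split (fun j => ev N (A j)) _ _ ('X)%:P).
  apply: tau_smallD; first exact: tau_smallM.
  apply: tau_small_sum => j _; apply/tau_smallM/tau_smallX.
  have -> : - ev N F - ('X)%:P * ev N G = - 1 * (ev N F + ('X)%:P * ev N G).
    by rewrite mulN1r opprD.
  exact: tau_smallM.
have coFG' : coprimep (- F) G by rewrite -scaleN1r coprimepZl // oppr_eq0 oner_eq0.
have sFG : (D < size (- F))%N || (D < size G)%N by rewrite size_polyN.
have A0 := binary_form_eq0 coFG' sFG (fun j => size_grid D E _) H0.
have E0 : (0 < E)%N by rewrite lt0n; apply: contraTneq t0w => ->; rewrite muln0.
move/negP: ut0; apply; apply/eqP/polyP => j; rewrite coef0.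
have [jm|mj] := leqP j m; last by rewrite nth_default // (leq_trans (um _ t0w)) // ltnW.
have := congr1 (fun P : {poly {poly K}} => P`_(t0 %/ E)`_(t0 %% E)) (A0 j jm).
by rewrite coef_grid ?ltn_divLR ?ltn_mod // -divn_eq !coef0.
Qed.

End Pencil.

(** * Choice of the branch and of the pencil *)

(** Compares the positive with the negative terms of the determinant with rows (a, b, 1), which
    avoids truncated subtraction. The variant [area] can vanish in K for a noncollinear triple. *)
Definition noncollinear (J : Type) (a b : J -> nat) (i j l : J) :=
  (a i * b j + a j * b l + a l * b i != a j * b i + a l * b j + a i * b l)%N.

Definition area (R : nzRingType) (J : Type) (a b : J -> nat) (i j l : J) : R :=
  ((a i)%:R - (a l)%:R) * ((b j)%:R - (b l)%:R) - ((a j)%:R - (a l)%:R) * ((b i)%:R - (b l)%:R).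

Lemma areaE (R : comNzRingType) (J : Type) (a b : J -> nat) (i j l : J) :
  area R a b i j l =
    (a i * b j + a j * b l + a l * b i)%:R - (a j * b i + a l * b j + a i * b l)%:R.
Proof. by rewrite /area !natrD !natrM; ring. Qed.

Lemma noncollinearE (J : Type) (a b : J -> nat) (i j l : J) :
  noncollinear a b i j l = (area int a b i j l != 0).
Proof. by rewrite areaE subr_eq0 eqr_nat. Qed.

Lemma natr_eq_mod (K : nzRingType) (p : nat) (m n : nat) : p \in [pchar K] ->
  ((m%:R == n%:R :> K) = (m == n %[mod p]))%N.
Proof.
move=> pK; wlog nm : m n / (n <= m)%N.
  by move=> H; case/orP: (leq_total n m) => /H // E; rewrite eq_sym E eq_sym.
by rewrite eqn_mod_dvd // (dvdn_pcharf pK) natrB // subr_eq0.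
Qed.

Lemma natr_neq_pchar0 (K : fieldType) (m n : nat) : ~ (exists p, p \in [pchar K]) ->
  m != n -> m%:R != n%:R :> K.
Proof.
move=> nK; wlog nm : m n / (n < m)%N.
  by move=> H; case: (ltngtP m n) => // h _; [rewrite eq_sym|]; apply: H; rewrite // gtn_eqF.
move=> _; apply/negP => /eqP E; apply: nK.
apply: (@natf0_pchar _ (m - n)); first by rewrite subn_gt0.
by rewrite natrB ?(ltnW nm) // E subrr.
Qed.

(* In characteristic p all differences of exponent vectors may be parallel modulo p. Replacing
   (a,b) by (k a + ga b, b), where ga makes the first entry of one difference highly divisible
   by p, and dividing the first entries by their common p-power q restores rank 2. *)
Lemma arc_exponents (K : fieldType) (J : eqType) (I : seq J) (a b : J -> nat) :
  (exists i j l, [/\ i \in I, j \in I, l \in I & noncollinear a b i j l]) ->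
  (exists i j, [/\ i \in I, j \in I & (b i)%:R != (b j)%:R :> K]) ->
  exists k ga r q (a' : J -> nat),
  [/\ (0 < k)%N, (0 < q)%N,
      (forall l, l \in I -> k * a l + ga * b l = r + q * a' l)%N,
      (1 + 'X) ^+ q = 1 + 'X^q :> {poly {poly K}} &
      exists i j l, [/\ i \in I, j \in I, l \in I & area K a' b i j l != 0]].
Proof.
move=> [i [j [l [iI jI lI nc]]]] Hb.
have [[p pK]|nK] := pselect (exists p, p \in [pchar K]); last first.
  exists 1%N, 0%N, 0%N, 1%N, a; split=> //.
  - by move=> x _; rewrite !mul1n mul0n addn0 add0n.
  - exists i, j, l; split=> //.
    by rewrite areaE subr_eq0 natr_neq_pchar0.
have [i0 [j0 [i0I j0I bK lt_b]]] :
    exists i0 j0, [/\ i0 \in I, j0 \in I, (b i0)%:R != (b j0)%:R :> K & (b j0 < b i0)%N].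
  have [i0 [j0 [i0I j0I bK]]] := Hb.
  have [lt|lt|E] := ltngtP (b i0) (b j0).
  - by exists j0, i0; rewrite eq_sym.
  - by exists i0, j0.
  - by rewrite E eqxx in bK.
pose k := (b i0 - b j0)%N.
have kZ : k%:R = (b i0)%:R - (b j0)%:R :> int by rewrite natrB // ltnW.
have kZ0 : k%:R != 0 :> int by rewrite pnatr_eq0 -lt0n subn_gt0.
(* Otherwise all points would lie on the line through [i0] and [j0], including the noncollinear [i],
   [j], [l]. *)
have [l0 l0I d0] : exists2 l0, l0 \in I & area int a b l0 i0 j0 != 0.
  apply: contrapT => nex.
  have par x : x \in I -> area int a b x i0 j0 = 0.
    by move=> xI; apply/eqP; apply: contrapT => /negP h; apply: nex; exists x.
  move: nc; rewrite noncollinearE => /negP; apply; rewrite -(mulIr_eq0 _ (mulIf kZ0)).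
  move: (par _ iI) (par _ jI) (par _ lI); rewrite /area -kZ.
  move: (k%:R : int) ((a i)%:R : int) ((a j)%:R : int) ((a l)%:R : int) => t u v w.
  move: ((b i)%:R : int) ((b j)%:R : int) ((b l)%:R : int) => u' v' w'.
  move: ((a i0)%:R - (a j0)%:R : int) ((a j0)%:R : int) ((b j0)%:R : int) => c x y.
  move=> /eqP; rewrite subr_eq0 => /eqP h1 /eqP; rewrite subr_eq0 => /eqP h2 /eqP.
  rewrite subr_eq0 => /eqP h3; apply/eqP.
  transitivity ((((u - x) * t - (w - x) * t)) * (v' - w') - (((v - x) * t) - (w - x) * t) * (u' - w')).
    by ring.
  rewrite h1 h2 h3; ring.
(* A nonzero integer of absolute value M is not divisible by p^M, because p^M > M. *)
pose M := `|area int a b l0 i0 j0|%N.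
have p_gt1 : (1 < p)%N := prime_gt1 (pcharf_prime pK).
(* A natural number congruent to a j0 - a i0 modulo p^M. It makes A x - A j0 congruent to the area
   of x, [i0], [j0]; in particular A i0 and A j0 agree modulo p^M. *)
pose ga := (a j0 + (p ^ M - 1) * a i0)%N.
have gaZ : ga%:R = (a j0)%:R + ((p ^ M)%:R - 1) * (a i0)%:R :> int.
  by rewrite natrD natrM natrB // expn_gt0 (ltnW p_gt1).
pose A x := (k * a x + ga * b x)%N.
have AZ x : (A x)%:R - (A j0)%:R = area int a b x i0 j0 + (p ^ M)%:R * ((a i0)%:R * ((b x)%:R - (b j0)%:R)) :> int.
  by rewrite /A /area !natrD !natrM gaZ kZ; ring.
pose P e := all (fun x => A x == A j0 %[mod p ^ e])%N I.
have nPM : ~~ P M.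
  apply/negP => /allP/(_ l0 l0I)/= h.
  have [z hz] : exists z : int, area int a b l0 i0 j0 = (p ^ M)%:R * z.
    exists ((A l0 %/ p ^ M)%:R - (A j0 %/ p ^ M)%:R - (a i0)%:R * ((b l0)%:R - (b j0)%:R)).
    rewrite mulrBr -[LHS](addrK ((p ^ M)%:R * ((a i0)%:R * ((b l0)%:R - (b j0)%:R)))) -AZ.
    congr (_ - _); rewrite {1}(divn_eq (A l0) (p ^ M)) {1}(divn_eq (A j0) (p ^ M)) (eqP h).
    by rewrite !natrD !natrM; ring.
  have MM : M = (p ^ M * `|z|)%N by rewrite {1}/M hz abszM natz absz_nat.
  have M0 : (0 < M)%N by rewrite absz_gt0.
  have : (p ^ M <= M)%N.
    by rewrite {2}MM leq_pmulr // lt0n; apply: contraTneq M0 => z0; rewrite MM z0 muln0.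
  by rewrite leqNgt ltn_expl.
(* p^f is the highest power of p modulo which all A x agree, so after division by it some first
   entry differs from that of [j0] modulo p. *)
have [f [Pf nPf fM]] : exists f, [/\ P f, ~~ P f.+1 & (f < M)%N].
  have ex : exists e, ~~ P e by exists M.
  case: (ex_minnP ex) => [[|f] nPf Hf]; first by case/negP: nPf; apply/allP => x _; rewrite expn0 !modn1.
  exists f; split=> //; last exact: Hf.
  by apply: contraT => /Hf; rewrite ltnn.
have [l1 l1I Al1] : exists2 l1, l1 \in I & A l1 != A j0 %[mod p ^ f.+1].
  by move: nPf; rewrite /P -has_predC => /hasP.
have q_gt0 : (0 < p ^ f)%N by rewrite expn_gt0 (ltnW p_gt1).
pose r := (A j0 %% p ^ f)%N; pose a' x := (A x %/ p ^ f)%N.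
have AE x : x \in I -> A x = (r + p ^ f * a' x)%N.
  by move=> /(allP Pf)/= /eqP E; rewrite /r -E addnC mulnC -divn_eq.
exists k, ga, r, (p ^ f)%N, a'; split=> //.
- by rewrite subn_gt0.
- rewrite exprDn_pchar ?expr1n // pnatX pnatE ?(pcharf_prime pK) //.
  by rewrite (rmorph_pchar (emb2 K) pK).
exists l1, i0, j0; split=> //.
have Ai0 : A i0 = (k * p ^ (M - f) * a i0 * p ^ f + A j0)%N.
  apply/eqP; rewrite -(eqr_nat int) natrD -subr_eq AZ /area; apply/eqP.
  rewrite -(subnK (ltnW fM)) {1}expnD subnK ?(ltnW fM) // -kZ !natrM; ring.
(* Since f < M, the entries of [i0] and [j0] still agree modulo p after the division, so the area is
   a product of two differences that are nonzero in K. *)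
have Ea : (a' i0)%:R = (a' j0)%:R :> K.
  rewrite /a' Ai0 divnMDl // natrD !natrM natrX (pcharf0 pK) expr0n subn_eq0 leqNgt fM.
  by rewrite mulr0 mul0r add0r.
rewrite /area Ea subrr mul0r subr0 mulf_neq0 ?subr_eq0 //.
rewrite (natr_eq_mod _ _ pK); apply: contra Al1.
by rewrite !AE // eqn_modDl expnSr -!muln_modr eqn_pmul2l.
Qed.

Section Coef.
Variables (K : fieldType) (J : eqType) (I : seq J) (a b : J -> nat).
Hypotheses (uI : uniq I) (a_inj : {in I &, injective a}).

Lemma coef_bipoly (f : J -> K) l : l \in I -> (bipoly I a b f)`_(a l) = (f l)%:P * 'X^(b l).
Proof.
move=> lI; rewrite /bipoly coef_sum (bigD1_seq l) //= big1_seq ?addr0 => [|x /andP[xl xI]].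
  by rewrite /xymon mulrA -polyCM coefCM coefXn eqxx mulr1.
rewrite /xymon mulrA -polyCM coefCM coefXn; case: eqP => [E|]; last by rewrite mulr0.
by rewrite (a_inj lI xI E) eqxx in xl.
Qed.

Lemma coef_bipoly_neq0 (f : J -> K) l : l \in I -> f l != 0 -> (bipoly I a b f)`_(a l) != 0.
Proof.
by move=> lI f0; rewrite coef_bipoly // mulf_neq0 ?polyC_eq0 // expf_neq0 ?polyX_eq0.
Qed.

Lemma bipoly_neq0 (f : J -> K) l : l \in I -> f l != 0 -> bipoly I a b f != 0.
Proof.
by move=> lI /(coef_bipoly_neq0 lI); apply: contraNneq => ->; rewrite coef0.
Qed.

Lemma size_bipoly (f : J -> K) d : (forall l, l \in I -> (a l <= d)%N) ->
  (size (bipoly I a b f) <= d.+1)%N.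
Proof.
move=> ad; apply: (leq_trans (size_sum _ _ _)); apply/bigmax_leqP_seq => l lI _.
rewrite /xymon mulrA -polyCM mul_polyC (leq_trans (size_scale_leq _ _)) // size_polyXn.
by rewrite ltnS ad.
Qed.

End Coef.

Section PencilChoice.
Variables (K : closedFieldType) (J : eqType) (I : seq J) (a b a' : J -> nat) (o m j : J).
Hypotheses (uI : uniq I) (oI : o \in I) (mI : m \in I) (jI : j \in I).
Hypothesis a_inj : {in I &, injective a}.
Hypothesis a_o : a o = 0%N.
Hypothesis off_line : (b m * a j + b o * a m != b j * a m + b o * a j)%N.
Variables (i1 i2 i3 : J).
Hypotheses (i1I : i1 \in I) (i2I : i2 \in I) (i3I : i3 \in I).
Hypothesis rank2 : area K a' b i1 i2 i3 != 0.

Definition moment (w : J -> K) (f : J -> K) : K := \sum_(l <- I) f l * w l.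

Lemma momentD w f1 f2 c : moment w (fun l => f1 l + c * f2 l) = moment w f1 + c * moment w f2.
Proof.
by rewrite /moment big_distrr -big_split; apply: eq_bigr => l _ /=; rewrite mulrDl mulrA.
Qed.

(** Coefficient vector of monomial [l] minus monomial [o]; such vectors span those on I with sum
    zero, that is, the polynomials vanishing at (1,1). *)
Definition diff_at (l x : J) : K := (x == l)%:R - (x == o)%:R.

Lemma moment_diff w l : l \in I -> moment w (diff_at l) = w l - w o.
Proof.
have pick z : z \in I -> \sum_(x <- I) (x == z)%:R * w x = w z.
  move=> zI; rewrite (bigD1_seq z) //= eqxx mul1r big1 ?addr0 // => x xz.
  by rewrite (negPf xz) mul0r.
move=> lI; rewrite /moment -(pick l lI) -(pick o oI) -sumrB.
by apply: eq_bigr => x _; rewrite mulrBl.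
Qed.

Local Notation wa := (fun l => (a' l)%:R : K).
Local Notation wb := (fun l => (b l)%:R : K).
Local Notation w1 := (fun=> 1 : K).

(** When this determinant is nonzero, combinations of [f] and [g] attain any prescribed pair of
    moments for a' and b. *)
Definition moment_det f g := moment wa f * moment wb g - moment wa g * moment wb f.

Lemma moment_detDl f h g c :
  moment_det (fun l => f l + c * h l) g = moment_det f g + c * moment_det h g.
Proof. by rewrite /moment_det !momentD; ring. Qed.

Lemma moment_detDr f h g c :
  moment_det g (fun l => f l + c * h l) = moment_det g f + c * moment_det g h.
Proof. by rewrite /moment_det !momentD; ring. Qed.

Lemma bipolyD (f h : J -> K) (c : K) : bipoly I a b (fun l => f l + c * h l)
  = bipoly I a b f + c%:P%:P * bipoly I a b h.
Proof.
rewrite /bipoly big_distrr -big_split; apply: eq_bigr => l _ /=.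
by rewrite !polyCD !polyCM mulrDl -[in LHS]mulrA.
Qed.

Lemma bipoly_diff l : l \in I -> bipoly I a b (diff_at l) = xymon K (a l) (b l) - xymon K 0 (b o).
Proof.
have pick z : z \in I ->
    \sum_(x <- I) ((x == z)%:R : K)%:P%:P * xymon K (a x) (b x) = xymon K (a z) (b z).
  move=> zI; rewrite (bigD1_seq z) //= eqxx mul1r big1 ?addr0 // => x xz.
  by rewrite (negPf xz) mul0r.
move=> lI; rewrite -a_o -(pick l lI) -(pick o oI) -sumrB.
by apply: eq_bigr => x _; rewrite /diff_at !polyCB mulrBl.
Qed.

Lemma bipoly_comb (f g : J -> K) (c d : K) : bipoly I a b (fun l => c * f l + d * g l)
  = c%:P%:P * bipoly I a b f + d%:P%:P * bipoly I a b g.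
Proof.
rewrite /bipoly !big_distrr -big_split; apply: eq_bigr => l _ /=.
by rewrite !polyCD !polyCM mulrDl !mulrA.
Qed.

Lemma moment_comb w f g c d :
  moment w (fun l => c * f l + d * g l) = c * moment w f + d * moment w g.
Proof.
by rewrite /moment !big_distrr -big_split; apply: eq_bigr => l _ /=; rewrite mulrDl !mulrA.
Qed.

(** The nonzero area of [i1], [i2], [i3] is a signed sum of three such determinants, so one of them
    is nonzero. *)
Lemma independent_diffs : exists l1 l2, [/\ l1 \in I, l2 \in I &
  moment_det (diff_at l1) (diff_at l2) != 0].
Proof.
apply: contrapT => nex; move/negP: rank2; apply; apply/eqP.
have det0 l1 l2 : l1 \in I -> l2 \in I -> moment_det (diff_at l1) (diff_at l2) = 0.
  by move=> h1 h2; apply/eqP; apply: contrapT => /negP h; apply: nex; exists l1, l2.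
transitivity (moment_det (diff_at i1) (diff_at i2) - moment_det (diff_at i1) (diff_at i3)
  - moment_det (diff_at i3) (diff_at i2)); last by rewrite !det0 // !subr0.
by rewrite /moment_det !moment_diff // /area; ring.
Qed.

(** The binomials at [j] and [m] are coprime because [j] is off the line through [o] and [m].
    Multiples of other vectors of sum zero are then added one at a time; each condition excludes
    only finitely many scalars. *)
Lemma generic_pencil : exists f g : J -> K,
  [/\ moment w1 f = 0 /\ moment w1 g = 0, moment_det f g != 0,
      coprimep (bipoly I a b f) (bipoly I a b g) & forall l, l \in I -> f l != 0].
Proof.
have [l1 [l2 [l1I l2I d12]]] := independent_diffs.
have sum0 l : l \in I -> moment w1 (diff_at l) = 0 by move=> lI; rewrite moment_diff ?subrr.
have co0 : coprimep (bipoly I a b (diff_at j)) (bipoly I a b (diff_at m)).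
  by rewrite !bipoly_diff // coprimep_xymon.
have nz (f g : J -> K) : moment_det f g != 0 -> bipoly I a b g != 0.
  move=> d0; have [l lI gl] : exists2 l, l \in I & g l != 0.
    apply: contrapT => nex; move/negP: d0; apply; rewrite /moment_det.
    have m0 w : moment w g = 0.
      rewrite /moment big1_seq // => l /andP[_ lI].
      have -> : g l = 0 by apply/eqP; apply: contrapT => /negP gl; apply: nex; exists l.
      by rewrite mul0r.
    by rewrite !m0 mulr0 mul0r subrr.
  exact: bipoly_neq0 lI gl.
have F0 : bipoly I a b (diff_at j) != 0.
  apply: (@bipoly_neq0 _ _ _ _ b uI a_inj (diff_at j) j jI); rewrite /diff_at eqxx.
  have -> : (j == o) = false by apply: contraNF off_line => /eqP ->; rewrite a_o !muln0 addnC.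
  by rewrite subr0 oner_eq0.
have [c1 [co1 d1]] : exists c, coprimep (bipoly I a b (fun l => diff_at m l + c * diff_at l2 l)) (bipoly I a b (diff_at j)) /\
    moment_det (diff_at l1) (diff_at m) + c * moment_det (diff_at l1) (diff_at l2) != 0.
  apply: cofinite_ex; apply: cofiniteI; last by apply: cofinite_affine; rewrite d12 orbT.
  rewrite coprimep_sym in co0.
  have [s Hs] := @coprimep_pencil K _ (polyC : {rmorphism K -> {poly K}}) _
    (bipoly I a b (diff_at l2)) _ co0 F0.
  by exists s => c /Hs; rewrite bipolyD.
pose g l := diff_at m l + c1 * diff_at l2 l.
rewrite -moment_detDr -/g in d1; rewrite -/g coprimep_sym in co1.
have G0 : bipoly I a b g != 0 := nz _ _ d1.
have [c2 [[co2 d2] no]] : exists c, (coprimep (bipoly I a b (fun l => diff_at j l + c * diff_at l1 l)) (bipoly I a b g) /\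
    moment_det (diff_at j) g + c * moment_det (diff_at l1) g != 0) /\ diff_at j o + c * diff_at l1 o != 0.
  apply: cofinite_ex; apply: cofiniteI; first apply: cofiniteI.
  - have [s Hs] := @coprimep_pencil K _ (polyC : {rmorphism K -> {poly K}}) _
      (bipoly I a b (diff_at l1)) _ co1 G0.
    by exists s => c /Hs; rewrite bipolyD.
  - by apply: cofinite_affine; rewrite d1 orbT.
  apply: cofinite_affine; apply/orP; right; rewrite /diff_at eqxx.
  have -> : (o == l1) = false.
    apply: contraNF d12 => /eqP <-.
    by rewrite /moment_det !moment_diff // !subrr !mul0r mulr0 subrr.
  by rewrite sub0r oppr_eq0 oner_eq0.
rewrite -moment_detDl in d2.
set f1 := fun l => diff_at j l + c2 * diff_at l1 l in co2 d2.
(* Coefficient 1 away from [o], and 1 - |I| at [o] to make the sum zero. As 1 - |I| may vanish in K,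
   the coefficient at [o] was made nonzero beforehand. *)
pose h l : K := 1 - (l == o)%:R * (size I)%:R.
have [c3 [[co3 d3] full]] : exists c, (coprimep (bipoly I a b (fun l => f1 l + c * h l)) (bipoly I a b g) /\
    moment_det f1 g + c * moment_det h g != 0) /\ forall l, l \in I -> f1 l + c * h l != 0.
  apply: cofinite_ex; apply: cofiniteI; first apply: cofiniteI.
  - have [s Hs] := @coprimep_pencil K _ (polyC : {rmorphism K -> {poly K}}) _
      (bipoly I a b h) _ co2 G0.
    by exists s => c /Hs; rewrite bipolyD.
  - by apply: cofinite_affine; rewrite d2.
  apply: cofinite_all => l lI; apply: cofinite_affine; rewrite /h.
  have [->|lo] := eqVneq l o; first by rewrite no.
  by rewrite mul0r subr0 oner_eq0 orbT.
rewrite -moment_detDl in d3.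
have hs : moment w1 h = 0.
  rewrite /moment; under eq_bigr do rewrite mulr1 /h.
  rewrite sumrB (big_nth o) sumr_const_nat subn0 (bigD1_seq o) //= eqxx mul1r.
  by rewrite big1 ?addr0 ?subrr // => x xo; rewrite (negPf xo) mul0r.
exists (fun l => f1 l + c3 * h l), g; split=> //; split.
  by rewrite momentD hs mulr0 addr0 /f1 momentD !sum0 // mulr0 addr0.
by rewrite /g momentD !sum0 // mulr0 addr0.
Qed.

End PencilChoice.

Lemma seq_argmax_int (T : eqType) (I : seq T) (f : T -> int) (x : T) : x \in I ->
  exists2 y, y \in I & forall z, z \in I -> f z <= f y.
Proof.
elim: I x => // y I IH x _.
have [->|[z zI]] : I = [::] \/ exists z, z \in I.
- by case: (I) => [|z r]; [left | right; exists z; rewrite mem_head].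
- by exists y; rewrite ?mem_head // => z; rewrite inE => /eqP->.
have [t tI Ht] := IH z zI.
have [yt|ty] := leP (f y) (f t).
  by exists t => [|u]; rewrite inE ?tI ?orbT // => /predU1P[->|/Ht].
exists y => [|u]; rewrite ?mem_head // inE => /predU1P[->|/Ht ut] //.
exact: le_trans ut (ltW ty).
Qed.

Lemma seq_argmax (T : eqType) (I : seq T) (f : T -> nat) (x : T) : x \in I ->
  exists2 y, y \in I & forall z, z \in I -> (f z <= f y)%N.
Proof.
move=> xI; have [y yI Hy] := seq_argmax_int (fun z => (f z)%:Z) xI.
by exists y => // z /Hy; rewrite lez_nat.
Qed.

Lemma noncollinear_off_line (J : eqType) (I : seq J) (a b : J -> nat) (o m : J) :
  {in I &, injective a} -> o \in I -> a o = 0%N -> (forall l, l \in I -> (a l <= a m)%N) ->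
  (exists i j l, [/\ i \in I, j \in I, l \in I & noncollinear a b i j l]) ->
  exists2 j, j \in I & (b m * a j + b o * a m != b j * a m + b o * a j)%N.
Proof.
move=> a_inj oI ao am [i [j [l [iI jI lI nc]]]]; apply: contrapT => nex.
have on x : x \in I -> (b x)%:R * (a m)%:R
    = (b m)%:R * (a x)%:R + (b o)%:R * (a m)%:R - (b o)%:R * (a x)%:R :> int.
  move=> xI; apply/eqP; rewrite eq_sym subr_eq -!natrM -!natrD eqr_nat.
  by apply: contrapT => /negP h; apply: nex; exists x.
have [am0|am0] := eqVneq (a m) 0%N.
  have eo x : x \in I -> x = o.
    by move=> xI; apply: a_inj => //; rewrite ao; apply/eqP; rewrite -leqn0 -am0 am.
  by move: nc; rewrite (eo _ iI) (eo _ jI) (eo _ lI) /noncollinear eqxx.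
have amZ : (a m)%:R != 0 :> int by rewrite pnatr_eq0.
move: nc; rewrite noncollinearE => /negP; apply; rewrite -(mulIr_eq0 _ (mulIf amZ)).
move: (on _ iI) (on _ jI) (on _ lI); rewrite /area.
move: ((a m)%:R : int) ((a i)%:R : int) ((a j)%:R : int) ((a l)%:R : int) => t u v w.
move: ((b i)%:R : int) ((b j)%:R : int) ((b l)%:R : int) => u' v' w'.
move: ((b m)%:R : int) ((b o)%:R : int) => c y h1 h2 h3; apply/eqP.
transitivity ((u - w) * (v' * t - w' * t) - (v - w) * (u' * t - w' * t)); first by ring.
rewrite h1 h2 h3; ring.
Qed.

Lemma bivariate_irreducible (K : closedFieldType) (J : eqType) (I : seq J) (a b : J -> nat)
    (o : J) : uniq I -> {in I &, injective a} -> o \in I -> a o = 0%N ->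
  (exists i j l, [/\ i \in I, j \in I, l \in I & noncollinear a b i j l]) ->
  (exists i j, [/\ i \in I, j \in I & (b i)%:R != (b j)%:R :> K]) ->
  exists2 c : J -> K, (forall l, l \in I -> c l != 0) &
    forall A B : {poly {poly K}}, A * B = bipoly I a b c -> (size A <= 1)%N || (size B <= 1)%N.
Proof.
move=> uI a_inj oI ao nc bK.
have [k [ga [r [q [a' [k0 q0 aE frob [i1 [i2 [i3 [i1I i2I i3I rank2]]]]]]]]]] := arc_exponents nc bK.
have [m mI am] := seq_argmax a oI.
have [j jI off] := noncollinear_off_line a_inj oI ao am nc.
have [F [G [[F1 G1] dFG coFG F0]]] :=
  generic_pencil uI oI mI jI a_inj ao off i1I i2I i3I rank2.
set wa := (fun l => (a' l)%:R : K) in F1 G1 dFG; pose wb l : K := (b l)%:R.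
have [d dE] : exists d, d = moment I wa F * moment I wb G - moment I wa G * moment I wb F by eexists.
have {}dFG : d != 0 by rewrite dE.
(* Cramer's rule: the basis of the pencil with moments (0, 1) and (-1, 0) for (a', b), as the branch
   construction requires. *)
pose f l := (- moment I wa G / d) * F l + (moment I wa F / d) * G l.
pose g l := (- moment I wb G / d) * F l + (moment I wb F / d) * G l.
have FE l : F l = moment I wb F * f l + - moment I wa F * g l.
  apply: (mulfI dFG); rewrite [in LHS]dE /f /g; field.
  exact: dFG.
have GE l : G l = moment I wb G * f l + - moment I wa G * g l.
  apply: (mulfI dFG); rewrite [in LHS]dE /f /g; field.
  exact: dFG.
have mom w : moment I w f = (- moment I wa G / d) * moment I w F + (moment I wa F / d) * moment I w G.
  exact: moment_comb.
have mog w : moment I w g = (- moment I wb G / d) * moment I w F + (moment I wb F / d) * moment I w G.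
  exact: moment_comb.
have fs : \sum_(l <- I) f l = 0.
  by under eq_bigr do rewrite -[f _]mulr1; rewrite -/(moment I (fun=> 1) f) mom F1 G1 !mulr0 addr0.
have gs : \sum_(l <- I) g l = 0.
  by under eq_bigr do rewrite -[g _]mulr1; rewrite -/(moment I (fun=> 1) g) mog F1 G1 !mulr0 addr0.
have fa : moment I wa f = 0 by rewrite mom; field.
have fb : moment I wb f = 1.
  by rewrite mom; apply: (mulfI dFG); rewrite [in RHS]dE; field.
have g_a : moment I wa g = -1.
  by rewrite mog; apply: (mulfI dFG); rewrite [in RHS]dE; field.
have gb : moment I wb g = 0 by rewrite mog; field.
have cofg : coprimep (bipoly I a b f) (bipoly I a b g).
  apply/coprimepP => e ef eg; move/coprimepP: coFG; apply.
    have -> : bipoly I a b F = bipoly I a b (fun l => moment I wb F * f l + - moment I wa F * g l).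
      by apply: eq_bigr => l _; rewrite -FE.
    by rewrite bipoly_comb dvdp_add // dvdp_mull.
  have -> : bipoly I a b G = bipoly I a b (fun l => moment I wb G * f l + - moment I wa G * g l).
    by apply: eq_bigr => l _; rewrite -GE.
  by rewrite bipoly_comb dvdp_add // dvdp_mull.
have fg l : l \in I -> (f l != 0) || (g l != 0).
  move=> lI; rewrite -negb_and; apply: contra (F0 l lI) => /andP[/eqP f0 /eqP g0].
  by rewrite FE f0 g0 !mulr0 addr0.
have big (h : J -> K) : h m != 0 -> (a m < size (bipoly I a b h))%N.
  move=> hm; rewrite ltnNge; apply/negP => /(nth_default 0) /eqP.
  by apply/negP/(coef_bipoly_neq0 b uI a_inj mI hm).
have sFG : (a m < size (bipoly I a b f))%N || (a m < size (bipoly I a b g))%N.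
  by have /orP[/big->|/big->] := fg m mI; rewrite ?orbT.
have [bad Hbad] : cofinite (fun s => forall l, l \in I -> f l + s * g l != 0).
  by apply: cofinite_all => l lI; apply/cofinite_affine/fg.
have [s sbad Hs] := pencil_irreducible k0 aE q0 frob fs gs fa fb g_a gb cofg sFG
  (size_bipoly b f am) (size_bipoly b g am) bad.
exists (fun l => f l + s * g l); first exact: Hbad.
by move=> A B; rewrite bipolyD; exact: Hs.
Qed.

(** * Reducible supports *)

Section Basics.
Variables (n : nat) (K : fieldType).
Implicit Types (P A B : {mpoly K[n]}) (m : 'X_{1..n}).

Lemma not_const_supp P m : m \in msupp P -> m <> 0%MM -> ~ mpoly_const P.
Proof.
by move=> mP m0 [c Pc]; move: mP; rewrite Pc msuppC; case: ifP; rewrite // inE => _ /eqP.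
Qed.

Lemma not_const_ex P : ~ mpoly_const P -> exists2 m, m \in msupp P & m <> 0%MM.
Proof.
move=> nc; apply: contrapT => nex; apply: nc; exists (P@_0%MM).
apply/mpolyP => m; rewrite mcoeffC; have [->|m0] := eqVneq 0%MM m; first by rewrite mulr1.
rewrite mulr0; apply/eqP; apply: contrapT => /negP; rewrite -mcoeff_msupp => mP.
by apply: nex; exists m => //; apply/eqP; rewrite eq_sym.
Qed.

Lemma reducible_set (I : {fset 'X_{1..n}}) :
  Zsupp K I = Vsupp K I <-> forall P, msupp P =i I -> mpoly_reducible P.
Proof.
split=> [E P PI|H].
  have : Vsupp K I P by [].
  by rewrite -E => -[].
apply/predeqP => P; split=> [[]//|PI]; split=> //; exact: H.
Qed.

Lemma cond_shift_reducible (I : {fset 'X_{1..n}}) P : I <> fset0 ->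
  cond_shift I -> msupp P =i I -> mpoly_reducible P.
Proof.
move=> I0 [t [It IU]] PI; pose Q := \sum_(m <- msupp P) P@_m *: 'X_[m - U_(t)].
have PQ : P = 'X_t * Q.
  rewrite {1}(mpolyE P) /Q big_distrr big_seq [RHS]big_seq; apply: eq_bigr => m /=.
  rewrite PI => /It [m' _ <-]; rewrite -scalerAr -mpolyXD.
  by congr (_ *: 'X_[_]); apply/mnmP => i; rewrite !mnmDE mnmBE mnmDE addKn.
exists 'X_t, Q; split=> //.
  apply: (@not_const_supp _ U_(t)%MM); first by rewrite msuppX inE.
  by move/eqP; rewrite mnm1_eq0.
move=> [c Qc]; apply: IU; apply/fsetP => m; rewrite -PI PQ Qc mulrC mul_mpolyC.
rewrite inE mcoeff_msupp mcoeffZ mcoeffX [U_(t)%MM == m]eq_sym.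
case: (m =P U_(t)%MM) => _; last by rewrite mulr0 eqxx.
rewrite mulr1; apply/eqP => c0; apply: I0; apply/fsetP => k.
by rewrite -PI PQ Qc c0 mulrC mul_mpolyC scale0r msupp0 !inE.
Qed.

End Basics.

Lemma mpoly_factor_const (n : nat) (K : fieldType) (A B : {mpoly K[n]}) :
  A * B != 0 -> mpoly_const (A * B) -> mpoly_const A.
Proof.
move=> AB0 [c ABc]; have := AB0; rewrite mulf_eq0 negb_or => /andP[A0 B0].
have : msize (A * B) = 1%N by move: AB0; rewrite ABc mpolyC_eq0 msizeC => ->.
rewrite msizeM // => sz; have B1 : (0 < msize B)%N by rewrite lt0n msize_poly_eq0.
have sA : (msize A <= 1)%N.
  by case: (msize B) B1 sz => // k _; rewrite addnS /= => <-; rewrite leq_addr.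
by exists (A@_0%MM); apply: msize1_polyC.
Qed.

Lemma pchar_root (K : closedFieldType) (p : nat) (c : K) : (0 < p)%N -> exists d, d ^+ p = c.
Proof.
move=> p0; pose q : {poly K} := 'X^p - c%:P.
have sq : size q != 1%N by rewrite size_XnsubC // eqSS -lt0n.
have [d rd] := closed_rootP q sq; exists d.
by move: rd; rewrite rootE hornerD hornerN hornerC hornerXn subr_eq0 => /eqP.
Qed.

(** Frobenius is additive and K contains p-th roots, so the root is taken term by term. *)
Lemma pth_root_mpoly (n : nat) (K : closedFieldType) (p : nat) (P : {mpoly K[n]}) :
  p \in [pchar K] -> (forall m, m \in msupp P -> exists m', m = (m' *+ p)%MM) ->
  exists Q, P = Q ^+ p.
Proof.
move=> pK Hm; have p0 : (0 < p)%N := prime_gt0 (pcharf_prime pK).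
have pP : p \in [pchar {mpoly K[n]}] := rmorph_pchar (@mpolyC n K) pK.
have hm (m : 'X_{1..n}) : exists m', m \in msupp P -> m = (m' *+ p)%MM.
  have [/Hm[m' E]|_] := boolP (m \in msupp P); first by exists m'.
  by exists 0%MM.
have [h Hh] := choice hm; have [r Hr] := choice (fun c : K => pchar_root c p0).
exists (\sum_(m <- msupp P) r P@_m *: 'X_[h m]).
rewrite -(pFrobenius_autE pP) rmorph_sum /= {1}(mpolyE P) big_seq [RHS]big_seq.
apply: eq_bigr => m mP; rewrite pFrobenius_autE exprZn mpolyXn Hr.
by rewrite -Hh.
Qed.

Lemma cond_char_reducible (n : nat) (K : closedFieldType) (I : {fset 'X_{1..n}})
    (P : {mpoly K[n]}) : I <> fset0 -> cond_char K I -> msupp P =i I -> mpoly_reducible P.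
Proof.
move=> I0 [p [pp pK I1 Ip]] PI.
have P0 : P != 0.
  by apply/eqP => P0; apply: I0; apply/fsetP => m; rewrite -PI P0 msupp0 inE.
have [Q PQ] : exists Q, P = Q ^+ p.
  by apply: (pth_root_mpoly pK) => m; rewrite PI => /Ip [m' _ <-]; exists m'.
have nP : ~ mpoly_const P.
  move=> [c Pc]; apply: I1; apply/fsetP => m; rewrite -PI Pc msuppC inE.
  by rewrite ifN ?inE // -(mpolyC_eq0 n) -Pc.
case: p pp pK Ip PQ => [|[|p]] // _ _ _ PQ.
have nQ : ~ mpoly_const Q by move=> [c Qc]; apply: nP; exists (c ^+ p.+2); rewrite PQ Qc rmorphXn.
exists Q, (Q ^+ p.+1); split=> //.
rewrite exprS => cQ; apply: nQ; apply: mpoly_factor_const cQ.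
by apply: contraNneq P0 => Q0; rewrite PQ 2!exprS Q0 mulr0.
Qed.

Lemma mnm_neqP (n : nat) (i j : 'X_{1..n}) : i <> j -> exists t, i t != j t.
Proof.
move=> ij; apply: contrapT => nex; apply: ij; apply/mnmP => t; apply/eqP.
by apply: contrapT => /negP h; apply: nex; exists t.
Qed.

Definition mnm_disjoint (n : nat) (i j : 'X_{1..n}) := forall t, (i t * j t = 0)%N.

(* The point of [i,j] with parameter e/N: for lattice points the parameter is rational. *)
Definition on_segment (n : nat) (i j m : 'X_{1..n}) := exists N e : nat,
  [/\ (0 < N)%N, (e <= N)%N & forall t, (N * m t = (N - e) * i t + e * j t)%N].

(** At a coordinate where [i] and [j] differ one of them is 0, which expresses the real parameter as
    a quotient of coordinates. *)
Lemma mnm_segmentP (R : realType) (n : nat) (i j m : 'X_{1..n}) :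
  mnm_disjoint i j -> i <> j -> mnm_segment R i j m -> on_segment i j m.
Proof.
move=> dij ij [la [la0 la1 Hm]].
have [t tij] := mnm_neqP ij.
have [it|jt] : i t = 0%N \/ j t = 0%N.
  by have /eqP := dij t; rewrite muln_eq0 => /orP[]/eqP; [left|right].
- have N0 : (0 < j t)%N by rewrite lt0n eq_sym -{1}it.
  have mt : (m t)%:R = la * (j t)%:R by rewrite Hm it mulr0 add0r.
  have le : (m t <= j t)%N by rewrite -(ler_nat R) mt ler_piMl.
  exists (j t), (m t); split=> // s; apply/eqP.
  by rewrite -(eqr_nat R) natrD !natrM natrB // Hm mt; apply/eqP; ring.
- have N0 : (0 < i t)%N by rewrite lt0n -jt.
  have mt : (m t)%:R = (1 - la) * (i t)%:R by rewrite Hm jt mulr0 addr0.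
  have le : (m t <= i t)%N.
    by rewrite -(ler_nat R) mt ler_piMl // lerBlDr lerDl.
  exists (i t), (i t - m t)%N; split=> //; first exact: leq_subr.
  move=> s; apply/eqP.
  by rewrite subKn // -(eqr_nat R) natrD !natrM natrB // Hm mt; apply/eqP; ring.
Qed.

Lemma mnm_segment_of (R : realType) (n : nat) (i j m : 'X_{1..n}) :
  on_segment i j m -> mnm_segment R i j m.
Proof.
move=> [N [e [N0 eN Hm]]]; have NR : N%:R != 0 :> R by rewrite pnatr_eq0 -lt0n.
exists (e%:R / N%:R); split.
- by rewrite divr_ge0 ?ler0n.
- by rewrite ler_pdivrMr ?ltr0n // mul1r ler_nat.
move=> t; apply: (mulfI NR); rewrite -natrM Hm natrD !natrM natrB //; field.
exact: NR.
Qed.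

Lemma dvdn_mul_mnm_gcd (n : nat) (i j : 'X_{1..n}) (N e : nat) :
  (forall t, N %| e * i t)%N -> (forall t, N %| e * j t)%N -> (N %| e * mnm_gcd i j)%N.
Proof.
have dvd_all (c : 'X_{1..n}) : (forall t, N %| e * c t)%N ->
    (N %| e * \big[gcdn/0%N]_(t < n) c t)%N.
  move=> H; have -> : (e * \big[gcdn/0%N]_(t < n) c t = \big[gcdn/0%N]_(t < n) (e * c t))%N.
    by apply: (big_morph (muln e)) => [x y|]; rewrite ?muln0 // muln_gcdr.
  by apply/dvdn_biggcdP => t _.
by move=> di dj; rewrite muln_gcdr dvdn_gcd !dvd_all.
Qed.

(** By disjointness N divides e i_t and e j_t separately for each t, hence N divides e g, and the
    parameter e/N has the form k/g. *)
Lemma on_segment_gcd (n : nat) (i j m : 'X_{1..n}) :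
  mnm_disjoint i j -> on_segment i j m ->
  exists2 k, (k <= mnm_gcd i j)%N &
    forall t, (mnm_gcd i j * m t = (mnm_gcd i j - k) * i t + k * j t)%N.
Proof.
move=> dij [N [e [N0 eN Hm]]]; set g := mnm_gcd i j.
have dN t : (N %| (N - e) * i t + e * j t)%N by rewrite -Hm dvdn_mulr.
have [di dj] : (forall t, N %| e * i t)%N /\ (forall t, N %| e * j t)%N.
  split=> t; have := dN t; have /eqP := dij t; rewrite muln_eq0 => /orP[]/eqP ->;
    rewrite ?muln0 ?addn0 ?add0n ?dvdn0 // mulnBl => H.
  by rewrite -(dvdn_subr (m := N * i t)) ?dvdn_mulr // leq_mul2r eN orbT.
have Ng : (N %| e * g)%N := dvdn_mul_mnm_gcd di dj.
have [k kE] := dvdnP Ng; exists k.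
  by rewrite -(leq_pmul2r N0) -kE mulnC leq_mul2l eN orbT.
move=> t; apply/eqP; rewrite -(eqn_pmul2l N0) mulnCA Hm mulnDr [(N * (_ + _))%N]mulnDr.
by rewrite !mulnA mulnBr mulnBr [(N * k)%N]mulnC -kE ![(g * _)%N]mulnC.
Qed.

Lemma homogenized_root (R : comNzRingType) (q : {poly R}) (r : R) (S : comNzRingType)
    (e : {rmorphism R -> S}) (U V : S) (g : nat) : (size q <= g)%N ->
  \sum_(0 <= k < g.+1) e (q * ('X - r%:P))`_k * (U ^+ (g - k) * V ^+ k)
  = (V - e r * U) * \sum_(0 <= k < g) e q`_k * (U ^+ (g.-1 - k) * V ^+ k).
Proof.
move=> sq; have co k : (q * ('X - r%:P))`_k = (if k == 0%N then 0 else q`_k.-1) - q`_k * r.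
  by rewrite mulrBr coefB coefMX coefMC.
under eq_bigr do rewrite co rmorphB rmorphM mulrBl; rewrite sumrB big_nat_recl // eqxx rmorph0 mul0r add0r.
rewrite [X in _ - X]big_nat_recr //= [q`_g]nth_default // rmorph0 !mul0r addr0.
rewrite mulrBl !big_distrr; congr (_ - _); apply: eq_big_nat => k /andP[_ kg] /=.
  rewrite (_ : g - k.+1 = g.-1 - k)%N ?exprS; last by case: g kg {sq} => // g _; rewrite subSS.
  by move: (U ^+ _) (V ^+ _) => x y; ring.
rewrite (_ : (g - k)%N = (g.-1 - k).+1) ?exprS; last by case: g kg {sq} => // g kg; rewrite subSn.
by move: (U ^+ _) (V ^+ _) => x y; ring.
Qed.

Lemma mnm_gcdP (n : nat) (i j : 'X_{1..n}) : exists u v : 'X_{1..n},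
  i = (u *+ mnm_gcd i j)%MM /\ j = (v *+ mnm_gcd i j)%MM.
Proof.
have di t : (mnm_gcd i j %| i t)%N.
  by apply: dvdn_trans (dvdn_gcdl _ _) _; apply: (biggcdn_inf t).
have dj t : (mnm_gcd i j %| j t)%N.
  by apply: dvdn_trans (dvdn_gcdr _ _) _; apply: (biggcdn_inf t).
exists [multinom (i t %/ mnm_gcd i j)%N | t < n], [multinom (j t %/ mnm_gcd i j)%N | t < n].
by split; apply/mnmP => t; rewrite mulmnE mnmE divnK.
Qed.

Lemma mnm_disjoint_neq (n : nat) (i j : 'X_{1..n}) :
  mnm_disjoint i j -> (0 < mnm_gcd i j)%N -> i <> j.
Proof.
move=> dij g0 E; have i0 : i = 0%MM.
  by apply/mnmP => t; rewrite mnm0E; have /eqP := dij t; rewrite -E muln_eq0 orbb => /eqP.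
by move: g0; rewrite -E i0 /mnm_gcd big1 // => t _; rewrite mnm0E.
Qed.

(** With i = g u and j = g v, P is a binary form of degree g in X^u and X^v. Over an algebraically
    closed field it has a linear factor V - r U, and g > 1 leaves a nonconstant cofactor. *)
Lemma cond_segment_reducible (R : realType) (n : nat) (K : closedFieldType)
    (I : {fset 'X_{1..n}}) (P : {mpoly K[n]}) :
  cond_segment R I -> msupp P =i I -> mpoly_reducible P.
Proof.
move=> [i [j [dij g1 iI jI Hseg]]] PI; set g := mnm_gcd i j in g1.
have g0 : (0 < g)%N by apply: ltnW.
have ij : i <> j := mnm_disjoint_neq dij g0.
have [u [v [iu jv]]] := mnm_gcdP i j; rewrite -/g in iu jv.
have uv : u != v by apply: contra_notN ij => /eqP uv; rewrite iu jv uv.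
pose w k : 'X_{1..n} := (u *+ (g - k) + v *+ k)%MM.
have duv t : (u t * v t = 0)%N.
  apply/eqP; move/eqP: (dij t); rewrite iu jv !mulmnE !muln_eq0.
  by rewrite (negPf (lt0n_neq0 g0)) !orbF.
have w_inj k k' : (k <= g)%N -> (k' <= g)%N -> w k = w k' -> k = k'.
  move=> kg kg' E; have [t tuv] := mnm_neqP (elimN eqP uv).
  have := congr1 (fun m : 'X_{1..n} => m t) E; rewrite !mnmDE !mulmnE.
  have /eqP := duv t; rewrite muln_eq0 => /orP[]/eqP h; rewrite h in tuv *.
    by rewrite !mul0n !add0n => /eqP; rewrite eqn_pmul2l ?lt0n 1?eq_sym // => /eqP.
  rewrite !mul0n !addn0 => /eqP; rewrite eqn_pmul2l ?lt0n // => /eqP E2.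
  by rewrite -(subKn kg) -(subKn kg') E2.
have wI m : m \in I -> exists2 k, (k <= g)%N & m = w k.
  move=> mI; have [k kg Hk] := on_segment_gcd dij (mnm_segmentP dij ij (Hseg m mI)).
  exists k => //; apply/mnmP => t; apply/eqP; rewrite -(eqn_pmul2l g0) Hk -/g mnmDE !mulmnE.
  by rewrite iu jv !mulmnE; apply/eqP; ring.
pose f : {poly K} := \poly_(k < g.+1) P@_(w k).
have fE k : (k <= g)%N -> f`_k = P@_(w k) by move=> kg; rewrite coef_poly ltnS kg.
have Pij m : m \in I -> P@_m != 0 by rewrite -PI mcoeff_msupp.
have fg : f`_g != 0.
  rewrite fE // (_ : w g = j) ?Pij // jv; apply/mnmP => t.
  by rewrite mnmDE !mulmnE subnn muln0.
have f0 : f`_0 != 0.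
  rewrite fE // (_ : w 0%N = i) ?Pij // iu; apply/mnmP => t.
  by rewrite mnmDE !mulmnE subn0 muln0 addn0.
have sf : size f != 1%N.
  by apply: contraNneq fg => sf; rewrite nth_default // sf.
have [r rf] := closed_rootP f sf.
have r0 : r != 0.
  by apply: contraNneq f0 => r0; move: rf; rewrite r0 rootE horner_coef0 => /eqP->.
have [q fq] := factor_theorem _ _ rf.
have sq : (size q <= g)%N.
  have : (size f <= g.+1)%N := size_poly _ _.
  by rewrite fq size_Mmonic ?monicXsubC ?size_XsubC ?addn2 //; apply: contraNneq fg => q0; rewrite fq q0 mul0r coef0.
pose U : {mpoly K[n]} := 'X_[u]; pose V : {mpoly K[n]} := 'X_[v].
have PE : P = (V - r%:MP * U) * \sum_(0 <= k < g) (q`_k)%:MP * (U ^+ (g.-1 - k) * V ^+ k).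
  have := homogenized_root r (@mpolyC n K) U V sq; rewrite -fq => <-.
  apply/mpolyP => m; rewrite raddf_sum big_mkord /=.
  have ck k : (k <= g)%N -> ((f`_k)%:MP * (U ^+ (g - k) * V ^+ k))@_m = P@_(w k) * (w k == m)%:R.
    by move=> kg; rewrite mcoeffCM fE // /U /V !mpolyXn -mpolyXD mcoeffX.
  have [[k0 k0g mk]|nex] := pselect (exists2 k, (k <= g)%N & m = w k).
    rewrite (bigD1 (inord k0)) //= ck inordK ?ltnS // mk eqxx mulr1 big1 ?addr0 // => k kk0.
    rewrite -mk ck -1?ltnS // mk; case: eqP => [/w_inj E|]; last by rewrite mulr0.
    by case/eqP: kk0; apply/val_inj; rewrite /= inordK ?ltnS // E // -ltnS.
  rewrite big1 => [|k _].
    apply/eqP; rewrite mcoeff_eq0 PI; apply/negP => /wI[k kg mk].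
    by apply: nex; exists k.
  rewrite ck -1?ltnS //; case: eqP => [E|]; last by rewrite mulr0.
  by case: nex; exists (k : nat); rewrite // -ltnS.
have coU m : (V - r%:MP * U)@_m = (v == m)%:R - r * (u == m)%:R.
  by rewrite mcoeffB mcoeffCM /U /V !mcoeffX.
exists (V - r%:MP * U), (\sum_(0 <= k < g) (q`_k)%:MP * (U ^+ (g.-1 - k) * V ^+ k)); split=> //.
  have [v0|v0] := eqVneq v 0%MM.
    apply: (@not_const_supp _ _ _ u); last by move=> u0; rewrite u0 v0 eqxx in uv.
    by rewrite mcoeff_msupp coU eqxx [v == u]eq_sym (negPf uv) mulr1 sub0r oppr_eq0.
  apply: (@not_const_supp _ _ _ v); last exact/eqP.
  by rewrite mcoeff_msupp coU eqxx (negPf uv) mulr0 subr0 oner_eq0.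
(* A constant cofactor would put i = g u and j = g v into {u, v}; with g > 1 and disjointness this
   forces u = v = 0. *)
move=> [c Qc]; rewrite Qc in PE.
have end_uv m : m \in I -> m = u \/ m = v.
  move=> mI; have := Pij m mI; rewrite PE mulrC mcoeffCM coU.
  have [->|_] := eqVneq v m; first by right.
  have [->|_] := eqVneq u m; first by left.
  by rewrite mulr0 subr0 mulr0 eqxx.
have shrink (x y : nat) : (x * y = 0 -> (x * g = x \/ x * g = y) -> x = 0)%N.
  move=> /eqP; rewrite muln_eq0 => /orP[/eqP->//|/eqP->] [] /eqP.
    by rewrite -{2}[x]muln1 eqn_mul2l => /orP[/eqP//|/eqP E]; rewrite E in g1.
  by rewrite muln_eq0 (negPf (lt0n_neq0 g0)) orbF => /eqP.
have u0 : u = 0%MM.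
  apply/mnmP => t; rewrite mnm0E; apply: (shrink _ _ (duv t)).
  have Et : i t = (u t * g)%N by rewrite {1}iu mulmnE.
  by rewrite -Et; case: (end_uv i iI) => ->; [left|right].
have v0 : v = 0%MM.
  apply/mnmP => t; rewrite mnm0E; have := duv t; rewrite mulnC => /shrink; apply.
  have Et : j t = (v t * g)%N by rewrite {1}jv mulmnE.
  by rewrite -Et; case: (end_uv j jI) => ->; [right|left].
by move: uv; rewrite u0 v0 eqxx.
Qed.

(** * Factors of multivariate polynomials *)

Section Factor.
Variables (n : nat) (K : fieldType).
Implicit Types (A B P : {mpoly K[n]}) (m : 'X_{1..n}).

(** The parts of top weight have a nonzero product, and no other pair of terms reaches that weight,
    so nothing cancels it. *)
Lemma factor_top A B (w : 'X_{1..n} -> int) : (forall m m', w (m + m')%MM = w m + w m') ->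
  A != 0 -> B != 0 ->
  exists a b, [/\ forall m, m \in msupp A -> w m <= w a, forall m, m \in msupp B -> w m <= w b,
     a \in msupp A, b \in msupp B & (a + b)%MM \in msupp (A * B)].
Proof.
move=> wD A0 B0.
have top C : C != 0 -> exists c : int, exists C1 C2 : {mpoly K[n]}, [/\ C = C1 + C2, C1 != 0,
    forall m, m \in msupp C -> w m <= c, forall m, m \in msupp C1 -> m \in msupp C /\ w m = c &
    forall m, m \in msupp C2 -> w m < c].
  move=> C0; have Cs : mlead C \in msupp C by rewrite mlead_supp.
  have [x xC Hx] := seq_argmax_int w Cs.
  have csum (p : pred 'X_{1..n}) m :
      (\sum_(k <- msupp C | p k) C@_k *: 'X_[k])@_m = if p m then C@_m else 0.
    rewrite raddf_sum -big_filter /=; have [mC|mC] := boolP (m \in [seq k <- msupp C | p k]).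
      rewrite (bigD1_seq m) ?filter_uniq //= mcoeffZ mcoeffX eqxx mulr1 big1 ?addr0 => [|k km].
        by move: mC; rewrite mem_filter => /andP[->].
      by rewrite mcoeffZ mcoeffX (negPf km) mulr0.
    rewrite big1_seq => [|k /andP[_ kC]]; last first.
      rewrite mcoeffZ mcoeffX; case: eqP => [E|]; last by rewrite mulr0.
      by rewrite -E kC in mC.
    case: ifP => // pm; move: mC; rewrite mem_filter pm /= => /memN_msupp_eq0 ->//.
  exists (w x), (\sum_(k <- msupp C | w k == w x) C@_k *: 'X_[k]),
    (\sum_(k <- msupp C | w k != w x) C@_k *: 'X_[k]); split=> //.
  - by rewrite {1}(mpolyE C) (bigID (fun k => w k == w x)).
  - apply/eqP => /(congr1 (mcoeff x)); rewrite csum eqxx mcoeff0 => /eqP.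
    by rewrite mcoeff_eq0 xC.
  - move=> m; rewrite mcoeff_msupp csum; case: (w m =P w x) => [->|]; last by rewrite eqxx.
    by rewrite -mcoeff_msupp.
  - move=> m; rewrite mcoeff_msupp csum; case: ifP => [mx|]; last by rewrite eqxx.
    by rewrite -mcoeff_msupp lt_neqAle mx => /Hx.
have [ca [A1 [A2 [EA A10 HA HA1 HA2]]]] := top A A0.
have [cb [B1 [B2 [EB B10 HB HB1 HB2]]]] := top B B0.
have AB0 : A1 * B1 != 0 by rewrite mulf_neq0.
have ms : mlead (A1 * B1) \in msupp (A1 * B1) by rewrite mlead_supp.
have /allpairsP[[a b] /= [aA bB Eab]] := msuppM_le ms.
have [aA' wa] := HA1 a aA; have [bB' wb] := HB1 b bB.
exists a, b; split=> //; [by move=> m /HA; rewrite wa | by move=> m /HB; rewrite wb |].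
have wm : w (a + b)%MM = ca + cb by rewrite wD wa wb.
have vanish (C D : {mpoly K[n]}) (c d : int) : c + d = ca + cb ->
    (forall m, m \in msupp C -> w m < c) -> (forall m, m \in msupp D -> w m <= d) ->
    (C * D)@_(a + b) = 0.
  move=> cd HC HD; apply/eqP; rewrite mcoeff_eq0; apply/negP => /msuppM_le.
  move=> /allpairsP[[x y] /= [xC yD E]]; move: wm; rewrite E wD => /eqP.
  by rewrite -cd lt_eqF // ltr_leD ?HC ?HD.
have -> : A * B = A1 * B1 + A2 * B + B2 * A1 by rewrite EA EB; ring.
rewrite mcoeff_msupp !mcoeffD (vanish A2 B ca cb) // (vanish B2 A1 cb ca) ?addr0 //.
- by rewrite -mcoeff_msupp -Eab.
- by rewrite addrC.
- by move=> m /HA1[_ ->].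
Qed.

Lemma monomial_factor A B a : a <> 0%MM -> (forall m, m \in msupp A -> m = a) ->
  exists t, forall m, m \in msupp (A * B) -> (0 < m t)%N.
Proof.
move=> a0 Aa; have [t] := mnm_neqP a0; rewrite mnm0E => at0.
exists t => m /msuppM_le /allpairsP[[x y] /= [/Aa -> _ ->]].
by rewrite mnmDE ltn_addr // lt0n.
Qed.

Lemma unit_irreducible P : P != 0 -> mpoly_const P -> ~ mpoly_reducible P.
Proof. by move=> P0 cP [A [B [nA _ E]]]; apply: nA; rewrite E in P0 cP; apply: mpoly_factor_const cP. Qed.

Lemma variable_irreducible (t : 'I_n) : ~ mpoly_reducible ('X_t : {mpoly K[n]}).
Proof.
move=> [A [B [nA nB E]]].
have X0 : 'X_t != 0 :> {mpoly K[n]} by rewrite -msize_poly_eq0 msizeX.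
have := X0; rewrite E mulf_eq0 negb_or => /andP[A0 B0].
have : msize (A * B)%R = 2%N by rewrite -E msizeX mdeg1.
have c1 (C : {mpoly K[n]}) : ~ mpoly_const C -> (1 < msize C)%N.
  move=> nC; rewrite ltnNge; apply/negP => C1; apply: nC.
  by exists C@_0%MM; apply: msize1_polyC.
rewrite msizeM //; move: (c1 A nA) (c1 B nB).
by case: (msize A) => [|[|x]] //; case: (msize B) => [|[|y]] // _ _; rewrite !addSn !addnS.
Qed.

End Factor.

Section Binomial.
Variables (n : nat) (K : fieldType) (i j : 'X_{1..n}) (P : {mpoly K[n]}).
Hypotheses (dij : mnm_disjoint i j) (gij : mnm_gcd i j = 1%N).
Hypothesis P_supp : msupp P =i [:: i; j].

Local Notation d t := ((i t)%:R - (j t)%:R : int).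

Lemma binomial_neq : i <> j.
Proof. by apply: mnm_disjoint_neq; rewrite ?gij. Qed.

Lemma binomial_neq0 : P != 0.
Proof. by apply/eqP => P0; have := P_supp i; rewrite P0 msupp0 !inE eqxx. Qed.

(** Linear forms that agree on [i] and [j] are constant on the support of A: their maxima over the
    two factors add up to the same value as their minima. So this support lies on a line parallel to
    i - j, a primitive vector, and distinct points on it differ by nonzero integer multiples of that
    vector. *)
Lemma binomial_width (A B : {mpoly K[n]}) (t : 'I_n) : P = A * B -> ~ mpoly_const A ->
  d t = 0 \/ exists l l',
    [/\ l \in msupp A, l' \in msupp A & (l' t)%:R + (`|d t|)%:Z <= (l t)%:R :> int].
Proof.
move=> E nA; have P0 := binomial_neq0.
have := P0; rewrite E mulf_eq0 negb_or => /andP[A0 B0].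
have const_on (x y : 'I_n) (l l' : 'X_{1..n}) : l \in msupp A -> l' \in msupp A ->
    d y * (l x)%:R - d x * (l y)%:R = d y * (l' x)%:R - d x * (l' y)%:R :> int.
  pose w (m : 'X_{1..n}) : int := d y * (m x)%:R - d x * (m y)%:R.
  have wD m m' : w (m + m')%MM = w m + w m' by rewrite /w !mnmDE !natrD; ring.
  have wij : w i = w j by rewrite /w; ring.
  have wP m : m \in msupp P -> w m = w i.
    by rewrite P_supp !inE => /orP[]/eqP->.
  have [a [b [Ha Hb aA bB abP]]] := factor_top wD A0 B0.
  have wND m m' : - w (m + m')%MM = - w m + - w m' by rewrite wD opprD.
  have [a' [b' [Ha' Hb' aA' bB' abP']]] := factor_top wND A0 B0.
  rewrite -E in abP abP'; have := wP _ abP; have := wP _ abP'; rewrite !wD => h' h.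
  have hb : w b' <= w b := Hb _ bB'.
  have eqw m : m \in msupp A -> w m = w a.
    move=> mA; apply/eqP; rewrite eq_le (Ha _ mA) /=; have := Ha' _ mA; rewrite lerN2.
    by apply: le_trans; rewrite -(lerD2r (w b')) h' -h lerD2l.
  by move=> lA l'A; rewrite -/(w l) -/(w l') (eqw _ lA) (eqw _ l'A).
have [a aA a0] := not_const_ex nA.
(* [A] has a second monomial, since no variable divides both X^i and X^j. *)
have [[l lA la]|nex] := pselect (exists2 l, l \in msupp A & l != a); last first.
  have [|s Hs] := @monomial_factor _ _ A B a a0.
    by move=> m mA; apply/eqP; apply: contrapT => /negP ma; apply: nex; exists m.
  have h x : x \in [:: i; j] -> (0 < x s)%N by rewrite -P_supp E; exact: Hs.
  have := dij s; move/eqP; rewrite muln_eq0 => /orP[]/eqP e0.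
    by have := h i; rewrite mem_head e0 => /(_ isT).
  by have := h j; rewrite !inE eqxx orbT e0 => /(_ isT).
have [dt0|dt] := eqVneq (d t) 0; [by left | right].
have xt : (l t)%:R - (a t)%:R != 0 :> int.
  apply/negP => /eqP x0; move/negP: la; apply; apply/eqP/mnmP => u; apply/eqP.
  rewrite -(eqr_nat int) -subr_eq0 -(mulrI_eq0 _ (mulfI dt)); apply/eqP.
  have := const_on u t l a lA aA => h.
  transitivity (d u * ((l t)%:R - (a t)%:R)); last by rewrite x0 mulr0.
  apply/eqP; rewrite -subr_eq0; apply/eqP; move: h => /eqP; rewrite -subr_eq0 => /eqP <-; ring.
(* Parallelism gives (l_t - a_t) d_u = d_t (l_u - a_u). Each nonzero i_u or j_u is d_u up to sign,
   so gcd 1 yields that d_t divides l_t - a_t. *)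
have key u : (`|d t| %| `|((l t)%:R - (a t)%:R : int)| * `|d u|)%N.
  have h := const_on t u l a lA aA.
  have -> : (`|((l t)%:R - (a t)%:R : int)| * `|d u| = `|d t| * `|((l u)%:R - (a u)%:R : int)|)%N.
    rewrite -!abszM; congr absz; apply/eqP; rewrite -subr_eq0; apply/eqP.
    by move/eqP: h; rewrite -subr_eq0 => /eqP <-; ring.
  exact: dvdn_mulr.
have dvd_x : (`|d t| %| `|((l t)%:R - (a t)%:R : int)|)%N.
  rewrite -[X in (_ %| X)%N]muln1 -gij; apply: dvdn_mul_mnm_gcd => u;
    have := key u; have := dij u; move/eqP; rewrite muln_eq0 => /orP[]/eqP ->;
    rewrite ?muln0 ?dvdn0 // ?subr0 ?sub0r ?abszN ?natz ?absz_nat //.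
have wid : (`|d t|)%:Z <= `|(l t)%:R - (a t)%:R : int|.
  by rewrite -abszE lez_nat dvdn_leq // absz_gt0.
have [le|le] := leP (a t)%:R ((l t)%:R : int).
  exists l, a; split=> //; move: wid; rewrite ger0_norm ?subr_ge0 //.
  by rewrite lerBrDl.
exists a, l; split=> //; move: wid; rewrite ltr0_norm ?subr_lt0 // opprB.
by rewrite lerBrDl.
Qed.

(** Widths in direction t add under multiplication; both factors have width at least |d_t|, while P
    has only |d_t| > 0. *)
Lemma binomial_irreducible : ~ mpoly_reducible P.
Proof.
move=> [A [B [nA nB E]]]; have P0 := binomial_neq0.
have := P0; rewrite E mulf_eq0 negb_or => /andP[A0 B0].
have [t tij] := mnm_neqP binomial_neq.
have dt : d t != 0 by rewrite subr_eq0 eqr_nat.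
have [d0|[l [l' [lA lA' hA]]]] := binomial_width t E nA; first by rewrite d0 eqxx in dt.
have E' : P = B * A by rewrite mulrC.
have [d0|[k [k' [kB kB' hB]]]] := binomial_width t E' nB; first by rewrite d0 eqxx in dt.
pose w (m : 'X_{1..n}) : int := (m t)%:R.
have wD m m' : w (m + m')%MM = w m + w m' by rewrite /w mnmDE natrD.
have wND m m' : - w (m + m')%MM = - w m + - w m' by rewrite wD opprD.
have [a [b [Ha Hb aA bB abP]]] := factor_top wD A0 B0.
have [a' [b' [Ha' Hb' aA' bB' abP']]] := factor_top wND A0 B0.
have hl := Ha _ lA; have hk := Hb _ kB.
have hl' : w a' <= w l' by rewrite -lerN2 Ha'.
have hk' : w b' <= w k' by rewrite -lerN2 Hb'.
have dpos : 0 < (`|d t|)%:Z by rewrite ltz_nat absz_gt0.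
have width : w (a + b)%MM - w (a' + b')%MM <= (`|d t|)%:Z.
  rewrite abszE; move: abP abP'; rewrite -E !P_supp !inE.
  move=> /orP[]/eqP-> /orP[]/eqP->; rewrite ?subrr ?normr_ge0 //; first exact: ler_norm.
  by rewrite distrC; exact: ler_norm.
move: width; rewrite !wD; move: hl hk hl' hk' hA hB dpos; rewrite /w.
move=> h1 h2 h3 h4 h5 h6 D0.
apply/negP; rewrite -ltNge; apply: lt_le_trans (lerB (lerD h1 h2) (lerD h3 h4)).
apply: lt_le_trans (lerB (lerD h5 h6) (lexx _)).
rewrite [X in _ < X](_ : _ = (`|d t|)%:Z + (`|d t|)%:Z); first by rewrite ltrDl.
ring.
Qed.

End Binomial.

(** * Kronecker substitution *)

Lemma base_digits_inj (B n : nat) (f g : 'I_n -> nat) :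
  (forall t, f t < B)%N -> (forall t, g t < B)%N ->
  (\sum_(t < n) f t * B ^ t = \sum_(t < n) g t * B ^ t)%N -> f =1 g.
Proof.
elim: n f g => [|n IH] f g fB gB; first by move=> _ [].
have step (h : 'I_n.+1 -> nat) : (\sum_(t < n.+1) h t * B ^ t
    = (\sum_(t < n) h (lift ord0 t) * B ^ t) * B + h ord0)%N.
  rewrite big_ord_recl expn0 muln1 addnC big_distrl; congr (_ + _)%N.
  by apply: eq_bigr => t _; rewrite lift0 expnSr mulnA.
rewrite !step => E; have B0 : (0 < B)%N by apply: leq_ltn_trans (fB ord0).
have E0 : f ord0 = g ord0.
  by have := congr1 (modn^~ B) E; rewrite !modnMDl !modn_small.
have E1 := IH (fun t => f (lift ord0 t)) (fun t => g (lift ord0 t)) (fun t => fB _) (fun t => gB _).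
have {}E1 := E1 _.
move=> t; have [t'|] := unliftP ord0 t; last by move=> ->.
move=> ->; apply: E1; move/eqP: E; rewrite E0 eqn_add2r eqn_pmul2r // => /eqP.
exact.
Qed.

Section Kronecker.
Variables (n : nat) (K : fieldType) (B : nat) (t0 : 'I_n).
Local Open Scope nat_scope.

Definition kron (m : 'X_{1..n}) := \sum_(t < n) m t * B ^ t.

Lemma kron_inj (m m' : 'X_{1..n}) :
  (forall t, m t < B) -> (forall t, m' t < B) -> kron m = kron m' -> m = m'.
Proof. by move=> mB mB' /(base_digits_inj mB mB') E; apply/mnmP. Qed.

Local Open Scope ring_scope.

Definition kron_var (t : 'I_n) : {poly {poly K}} := xymon K (B ^ t) (t == t0).

Definition kron_sub : {rmorphism {mpoly K[n]} -> {poly {poly K}}} := mmap (emb2 K) kron_var.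

Lemma kron_subE (P : {mpoly K[n]}) :
  kron_sub P = bipoly (msupp P) kron (fun m => m t0) (fun m => P@_m).
Proof.
rewrite /= /mmap /bipoly; apply: eq_bigr => m _; congr (_ * _).
have xyM a b a' b' : xymon K (a + a') (b + b') = xymon K a b * xymon K a' b'.
  by rewrite /xymon !exprD polyCM; ring.
have xyX a b k : xymon K a b ^+ k = xymon K (k * a) (k * b).
  elim: k => [|k IH]; first by rewrite !mul0n /xymon !expr0 mulr1 polyC1.
  by rewrite exprS IH !mulSn xyM.
have xyP (f g : 'I_n -> nat) : \prod_(t < n) xymon K (f t) (g t)
    = xymon K (\sum_(t < n) f t) (\sum_(t < n) g t).
  elim/big_rec3: _ => [|t x y z _ ->]; last by rewrite xyM.
  by rewrite /xymon !expr0 mulr1 polyC1.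
rewrite /mmap1 /kron_var; under eq_bigr do rewrite xyX.
rewrite xyP; congr (xymon _ _ _).
rewrite (bigD1 t0) //= eqxx muln1 big1 ?addn0 // => t tt0.
by rewrite (negPf tt0) muln0.
Qed.

End Kronecker.

Lemma split_Xn (R : idomainType) (p : {poly R}) : p != 0 ->
  exists q k, p = q * 'X^k /\ q`_0 != 0.
Proof.
move=> p0; have [k [q /implyP/(_ p0) nr E]] := multiplicity_XsubC p 0.
exists q, k; split; first by rewrite E subr0.
by rewrite -horner_coef0.
Qed.

Lemma eq_split_Xn (R : idomainType) (p q : {poly R}) (i j : nat) :
  p`_0 != 0 -> q`_0 != 0 -> p * 'X^i = q * 'X^j -> p = q.
Proof.
wlog ij : p q i j / (i <= j)%N.
  by move=> H p0 q0 E; case/orP: (leq_total i j) => ij; [apply: H E | apply/esym; apply: H (esym E)].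
move=> p0 q0; rewrite -(subnK ij) exprD mulrA => /mulIf H.
have {}H : p = q * 'X^(j - i) by apply: H; rewrite expf_neq0 // polyX_eq0.
case: (j - i)%N H => [|k] H; first by rewrite H mulr1.
by move: p0; rewrite H coefMXn eqxx.
Qed.

Lemma noncollinear_irreducible (n : nat) (K : closedFieldType) (I : {fset 'X_{1..n}}) (t0 : 'I_n) :
  (forall t : 'I_n, exists2 m, m \in I & m t = 0%N) ->
  (exists i j : 'X_{1..n}, [/\ i \in I, j \in I & (i t0)%:R != (j t0)%:R :> K]) ->
  (exists i j k t, [/\ i \in I, j \in I, k \in I &
     noncollinear (fun m : 'X_{1..n} => m t) (fun m => m t0) i j k]) ->
  exists2 P : {mpoly K[n]}, msupp P =i I & ~ mpoly_reducible P.
Proof.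
move=> no_var sepK [i [j [k [t [iI jI kI nc]]]]].
have [mx mxI Hmx] := seq_argmax (fun m : 'X_{1..n} => mdeg m) iI.
(* [B] exceeds d, which bounds the exponents in P and its factors, and 3 d^2, which bounds the sums
   of three products in the collinearity test. *)
pose d := mdeg mx; pose B := (3 * d * d + d).+1.
have coord (m : 'X_{1..n}) s : (m s <= mdeg m)%N by rewrite mdegE (bigD1 s) //= leq_addr.
have coordI m s : m \in I -> (m s <= d)%N by move=> mI; apply: leq_trans (coord m s) (Hmx m mI).
have coordB m s : m \in I -> (m s < B)%N.
  by move=> mI; rewrite ltnS (leq_trans (coordI m s mI)) // leq_addl.
(* [o] has the least Kronecker exponent; subtracting it provides the point with [a o = 0]. *)
have [o oI Ho] := @seq_argmax_int _ I (fun m : 'X_{1..n} => - (kron B m)%:R) i iI.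
have {}Ho m : m \in I -> (kron B o <= kron B m)%N.
  by move=> /Ho; rewrite lerN2 ler_nat.
pose a (m : 'X_{1..n}) := (kron B m - kron B o)%N; pose b (m : 'X_{1..n}) := m t0.
have a_inj : {in I &, injective a}.
  move=> x y xI yI /eqP; rewrite /a eqn_sub2rE ?Ho // => /eqP.
  by apply: kron_inj => s; apply: coordB.
have nca : noncollinear a b i j k.
  (* Both sides of the test are base-B numerals without carries whose digit at s is the same test
     for coordinate s; by [nc] they differ at the digit t. *)
  have ncB : noncollinear (kron B) b i j k.
    pose f (x y z : 'X_{1..n}) (s : 'I_n) := (x s * y t0 + y s * z t0 + z s * x t0)%N.
    have kf x y z : (kron B x * b y + kron B y * b z + kron B z * b x = \sum_(s < n) f x y z s * B ^ s)%N.
      rewrite /kron /b !big_distrl -!big_split; apply: eq_bigr => s _ /=; rewrite /f; ring.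
    have fB x y z s : x \in I -> y \in I -> z \in I -> (f x y z s < B)%N.
      move=> xI yI zI; rewrite ltnS /f; have := coordI x; have := coordI y; have := coordI z => hz hy hx.
      apply: (@leq_trans (d * d + d * d + d * d)); last by nia.
      by rewrite !leq_add // leq_mul ?hx ?hy ?hz.
    rewrite /noncollinear; apply: contra nc => /eqP E.
    have E' : (\sum_(s < n) f i j k s * B ^ s = \sum_(s < n) f j i k s * B ^ s)%N.
      rewrite -!kf E; ring.
    have := base_digits_inj (fun s => fB i j k s iI jI kI) (fun s => fB j i k s jI iI kI) E' t.
    by rewrite /f => ->; apply/eqP; ring.
  rewrite noncollinearE in ncB; rewrite noncollinearE.
  have aE x : x \in I -> (a x)%:R = (kron B x)%:R - (kron B o)%:R :> int.
    by move=> xI; rewrite natrB ?Ho.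
  move: ncB; rewrite /area !aE //; congr (_ != 0); ring.
have [c c0 irr] : exists2 c : 'X_{1..n} -> K, (forall m, m \in I -> c m != 0) &
    forall X Y : {poly {poly K}}, X * Y = bipoly I a b c -> (size X <= 1)%N || (size Y <= 1)%N.
  apply: (@bivariate_irreducible K _ I a b o (fset_uniq I) a_inj oI (subnn _)).
    by exists i, j, k.
  by have [x [y [xI yI xy]]] := sepK; exists x, y.
pose P : {mpoly K[n]} := \sum_(m <- I) c m *: 'X_[m].
have Pc m : P@_m = if m \in I then c m else 0.
  rewrite raddf_sum /=; case: ifPn => mI.
    rewrite (bigD1_seq m) ?fset_uniq //= mcoeffZ mcoeffX eqxx mulr1 big1 ?addr0 // => x xm.
    by rewrite mcoeffZ mcoeffX (negPf xm) mulr0.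
  rewrite big1_seq // => x /andP[_ xI]; rewrite mcoeffZ mcoeffX.
  by case: eqP => [E|]; rewrite ?mulr0 //; rewrite -E xI in mI.
have PI : msupp P =i I.
  move=> m; rewrite mcoeff_msupp Pc; case: ifP => [mI|]; last by rewrite eqxx.
  exact: c0.
exists P => // -[A [C [nA nC E]]].
pose phi := kron_sub K B t0.
have P0 : P != 0 by apply/eqP => P0; have := PI i; rewrite P0 msupp0 iI.
have := P0; rewrite E mulf_eq0 negb_or => /andP[A0 C0].
have sP : (msize P <= d.+1)%N.
  rewrite msizeE; apply/bigmax_leqP_seq => m mP _; rewrite ltnS; apply: Hmx.
  by rewrite -PI.
have factorB X Y : P = X * Y -> X != 0 -> Y != 0 -> forall m s, m \in msupp X -> (m s < B)%N.
  move=> EP X0 Y0 m s mX; rewrite ltnS (leq_trans (coord m s)) //.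
  apply: (@leq_trans d); last exact: leq_addl.
  rewrite -ltnS; apply: leq_trans sP; apply: leq_trans (msize_mdeg_lt mX) _.
  rewrite EP msizeM //; have : (0 < msize Y)%N by rewrite lt0n msize_poly_eq0.
  by case: (msize Y) => // y _; rewrite addnS leq_addr.
have phi_coef X Y m : P = X * Y -> X != 0 -> Y != 0 -> m \in msupp X -> (phi X)`_(kron B m) != 0.
  move=> EP X0 Y0 mX; rewrite /phi kron_subE; apply: coef_bipoly_neq0 => //.
    move=> x y xX yX; apply: kron_inj => s; exact: factorB EP X0 Y0 _ s _.
  by rewrite -mcoeff_msupp.
have phi_neq0 X Y : P = X * Y -> X != 0 -> Y != 0 -> phi X != 0.
  move=> EP X0 Y0; have mX : mlead X \in msupp X by rewrite mlead_supp.
  by apply: contraNneq (phi_coef _ _ _ EP X0 Y0 mX) => ->; rewrite coef0.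
have E' : P = C * A by rewrite mulrC.
(* Powers of x are removed from the images of the factors; the rests multiply to the bivariate
   polynomial, whose constant term in x is nonzero by the choice of [o]. *)
have [A1 [ka [EA A10]]] := split_Xn (phi_neq0 _ _ E A0 C0).
have [C1 [kc [EC C10]]] := split_Xn (phi_neq0 _ _ E' C0 A0).
have phiP : phi P = bipoly I a b c * 'X^(kron B o).
  rewrite /phi kron_subE /bipoly big_distrl.
  rewrite (perm_big (enum_fset I)) /=; last by apply: uniq_perm; [exact: msupp_uniq | exact: fset_uniq | exact: PI].
  rewrite !big_seq; apply: eq_bigr => m mI /=.
  by rewrite Pc (mI : m \in I) /xymon -!mulrA -exprD subnK // Ho.
have AC1 : A1 * C1 = bipoly I a b c.
  apply: (@eq_split_Xn _ _ _ (ka + kc) (kron B o)).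
  - by rewrite coefM big_ord1 mulf_neq0.
  - by have := coef_bipoly_neq0 b (fset_uniq I) a_inj oI (c0 o oI); rewrite /a subnn.
  by rewrite -phiP E rmorphM EA EC exprD; ring.
(* All monomials of such a factor share one Kronecker exponent, so it is a single monomial; being
   nonconstant, it would make some variable divide P. *)
have absurd X Y X1 kx : P = X * Y -> X != 0 -> Y != 0 -> ~ mpoly_const X ->
    phi X = X1 * 'X^kx -> (size X1 <= 1)%N -> False.
  move=> EP X0 Y0 nX EX sX; have kE m : m \in msupp X -> kron B m = kx.
    move=> /(phi_coef _ _ _ EP X0 Y0); rewrite EX (size1_polyC sX) coefCM coefXn.
    by case: (kron B m =P kx) => // _; rewrite mulr0 eqxx.
  have [e eX e0] := not_const_ex nX.
  have [|s Hs] := @monomial_factor _ _ X Y e e0.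
    move=> m mX; apply: (@kron_inj _ B); rewrite ?kE // => s; exact: factorB EP X0 Y0 _ s _.
  have [m mI ms] := no_var s; have := Hs m; rewrite -EP PI ms => /(_ mI); by [].
by have /orP[s1|s1] := irr _ _ AC1; [exact: absurd E A0 C0 nA EA s1 | exact: absurd E' C0 A0 nC EC s1].
Qed.

(** * Main theorem *)

Lemma nonzero_coord (n : nat) (I : {fset 'X_{1..n}}) :
  I <> [fset 0%MM]%fset -> I <> fset0 -> exists (x : 'X_{1..n}) t, x \in I /\ x t != 0%N.
Proof.
move=> I1 I0; apply: contrapT => nex; have all0 m : m \in I -> m = 0%MM.
  move=> mI; apply: contrapT => /mnm_neqP[s]; rewrite mnm0E => ms.
  by apply: nex; exists m, s.
have [m mI] : exists m, m \in I by apply/fset0Pn/eqP.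
apply: I1; apply/fsetP => y; rewrite inE; apply/idP/eqP => [/all0//|->].
by rewrite -(all0 m mI).
Qed.

(** The endpoints are a point [i] with zero t-th coordinate and a point [j] with the largest one.
    Collinearity in each projection (t, s) puts I on [i,j], and if the gcd is 1 this segment has no
    inner lattice point. *)
Lemma collinear_dichotomy (n : nat) (R : realType) (I : {fset 'X_{1..n}}) :
  (forall t : 'I_n, exists2 m, m \in I & m t = 0%N) -> I <> [fset 0%MM]%fset -> I <> fset0 ->
  (forall i j k (t u : 'I_n), i \in I -> j \in I -> k \in I ->
     ~~ noncollinear (fun m : 'X_{1..n} => m t) (fun m => m u) i j k) ->
  cond_segment R I \/
  exists i j, [/\ mnm_disjoint i j, mnm_gcd i j = 1%N & I =i [:: i; j]].
Proof.
move=> no_var I1 I0 col.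
have [x [t [xI xt]]] := nonzero_coord I1 I0.
have [j jI Hj] := seq_argmax (fun m : 'X_{1..n} => m t) xI.
have jt : (0 < j t)%N by apply: leq_trans (Hj _ xI); rewrite lt0n.
have [i iI it] := no_var t.
have seg m : m \in I -> forall s, (j t * m s = (j t - m t) * i s + m t * j s)%N.
  move=> mI s; have := col m i j t s mI iI jI; rewrite negbK it !mul0n addn0 add0n => /eqP E.
  rewrite mulnBl; have := leq_mul (Hj m mI) (leqnn (i s)); move: E.
  move: (m t * i s)%N (j t * m s)%N (j t * i s)%N (m t * j s)%N => x1 x2 x3 x4; lia.
have onseg m : m \in I -> on_segment i j m.
  by move=> mI; exists (j t), (m t); split=> //; [exact: Hj | exact: seg].
(* A point of I with s-th coordinate 0 is a convex combination of [i] and [j], so an endpoint of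
   positive weight has s-th coordinate 0 too. *)
have dij : mnm_disjoint i j.
  move=> s; have [m mI ms] := no_var s; have := seg m mI s; rewrite ms muln0 => /esym/eqP.
  rewrite addn_eq0 !muln_eq0 => /andP[/orP[h1|/eqP->//] /orP[h2|/eqP->]]; rewrite ?muln0 //.
  by move: h1; rewrite (eqP h2) subn0 => /eqP h1; rewrite h1 in jt.
have [g1|g1|g1] := ltngtP (mnm_gcd i j) 1%N.
- have [u [v [iu jv]]] := mnm_gcdP i j; move: g1 iu jv; rewrite ltnS leqn0 => /eqP -> _ jv.
  by move: jt; rewrite jv mulmnE muln0.
- by left; exists i, j; split=> // m /onseg; exact: mnm_segment_of.
right; exists i, j; split=> // m; rewrite !inE; apply/idP/orP => [mI|[]/eqP->//].
have [k kg Hk] := on_segment_gcd dij (onseg m mI); move: kg Hk; rewrite g1.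
case: k => [|[|k]] // _ Hk; [left | right]; apply/eqP/mnmP => s; have := Hk s.
  by rewrite subn0 !mul1n mul0n addn0.
by rewrite subnn !mul1n mul0n.
Qed.

(** Each coordinate takes the value 0 on I, so equality in K makes all coordinates zero in K; a
    nonzero one then forces positive characteristic. *)
Lemma same_coords_cond_char (n : nat) (K : fieldType) (I : {fset 'X_{1..n}}) :
  (forall t : 'I_n, exists2 m, m \in I & m t = 0%N) -> I <> [fset 0%MM]%fset -> I <> fset0 ->
  (forall i j (t : 'I_n), i \in I -> j \in I -> (i t)%:R = (j t)%:R :> K) -> cond_char K I.
Proof.
move=> no_var I1 I0 same.
have z m (t : 'I_n) : m \in I -> (m t)%:R = 0 :> K.
  by move=> mI; have [k kI kt] := no_var t; rewrite (same m k t mI kI) kt.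
have [x [t [xI xt]]] := nonzero_coord I1 I0.
have [||p pK] := @natf0_pchar K (x t); [by rewrite lt0n | by rewrite z |].
exists p; split=> //; first exact: pcharf_prime pK.
move=> m mI; exists [multinom (m s %/ p)%N | s < n] => //.
by apply/mnmP => s; rewrite mulmnE mnmE divnK // (dvdn_pcharf pK) z.
Qed.

Theorem theorem1p3 (R : realType) (K : closedFieldType) (n : nat)
    (n_ge1 : (1 <= n)%N) (I : {fset 'X_{1..n}}) (I_neq0 : I <> fset0) :
  Zsupp K I = Vsupp K I <->
  cond_shift I \/ cond_segment R I \/ cond_char K I.
Proof.
split; last first.
  move=> H; apply/reducible_set => P PI; case: H => [H|[H|H]].
  - exact: cond_shift_reducible I_neq0 H PI.
  - exact: cond_segment_reducible H PI.
  - exact: cond_char_reducible I_neq0 H PI.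
move/reducible_set => red; apply: contrapT => /not_orP[nshift /not_orP[nseg nchar]].
(* The irreducible polynomials 1 and X_t exclude the one-point supports {0} and {e_t}; then failure
   of (i) means that no variable divides all monomials. *)
have I1 : I <> [fset 0%MM]%fset.
  move=> E; apply: (@unit_irreducible n K 1); [exact: oner_neq0 | by exists 1 | apply: red].
  by move=> m; rewrite msupp1 E !inE.
have IU t : I <> [fset U_(t)%MM]%fset.
  move=> E; apply: (@variable_irreducible n K t); apply: red => m.
  by rewrite msuppX E !inE.
have no_var (t : 'I_n) : exists2 m, m \in I & m t = 0%N.
  apply: contrapT => nex; apply: nshift; exists t; split=> // m mI.
  have mt : m t != 0%N by apply/negP => /eqP mt; apply: nex; exists m.
  by exists (m - U_(t))%MM => //; rewrite addmC submK // lep1mP.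
have [col|ncol] := pselect (forall i j k (t u : 'I_n), i \in I -> j \in I -> k \in I ->
     ~~ noncollinear (fun m : 'X_{1..n} => m t) (fun m => m u) i j k).
  have [//|[i [j [dij gij Iij]]]] := collinear_dichotomy R no_var I1 I_neq0 col.
  have supp : msupp ('X_[i] + 'X_[j] : {mpoly K[n]}) =i [:: i; j].
    have ij : i != j by apply/eqP/mnm_disjoint_neq; rewrite ?gij.
    move=> m; rewrite mcoeff_msupp mcoeffD !mcoeffX !inE ![m == _]eq_sym.
    have [<-|im] := eqVneq i m; first by rewrite [j == i]eq_sym (negPf ij) addr0 oner_eq0.
    by have [jm|jm] := eqVneq j m; rewrite ?add0r ?addr0 ?oner_eq0 ?eqxx.
  apply: (binomial_irreducible dij gij supp); apply: red => m; by rewrite supp Iij.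
have [same|nsame] := pselect (forall i j (t : 'I_n), i \in I -> j \in I -> (i t)%:R = (j t)%:R :> K).
  exact/nchar/same_coords_cond_char.
have [i [j [t0 [iI jI ij]]]] : exists i j (t0 : 'I_n), [/\ i \in I, j \in I & (i t0)%:R != (j t0)%:R :> K].
  apply: contrapT => nex; apply: nsame => i j t iI jI; apply/eqP; apply: contrapT => /negP h.
  by apply: nex; exists i, j, t.
(* As i and j differ at [t0], the projections to the pairs (t, t0) determine the line through them.
   If all these were collinear, I would lie on one line, against [ncol]. *)
have nc : exists i j k t, [/\ i \in I, j \in I, k \in I &
     noncollinear (fun m : 'X_{1..n} => m t) (fun m => m t0) i j k].
  apply: contrapT => nex; apply: ncol => x y z t u xI yI zI; rewrite noncollinearE negbK.
  have on m s : m \in I -> area int (fun m : 'X_{1..n} => m s) (fun m => m t0) m j i = 0.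
    move=> mI; apply/eqP; apply: contrapT => /negP; rewrite -noncollinearE => h.
    by apply: nex; exists m, j, i, s.
  have c0 : (j t0)%:R - (i t0)%:R != 0 :> int.
    by rewrite subr_eq0 eqr_nat; apply: contra ij => /eqP->.
  have par m s : m \in I -> (m s)%:R * ((j t0)%:R - (i t0)%:R)
      = (i s)%:R * ((j t0)%:R - (i t0)%:R) + ((j s)%:R - (i s)%:R) * ((m t0)%:R - (i t0)%:R) :> int.
    by move=> mI; have /eqP := on m s mI; rewrite -subr_eq0 => /eqP E;
      apply/eqP; rewrite -subr_eq0 -[X in _ == X]E /area; apply/eqP; ring.
  rewrite -(mulIr_eq0 _ (mulIf c0)) -(mulIr_eq0 _ (mulIf c0)) /area; apply/eqP.
  set c := (_ - _ : int) in c0 par *.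
  transitivity (((x t)%:R * c - (z t)%:R * c) * ((y u)%:R * c - (z u)%:R * c)
    - ((y t)%:R * c - (z t)%:R * c) * ((x u)%:R * c - (z u)%:R * c)); first by ring.
  by rewrite (par x t) // (par y t) // (par z t) // (par x u) // (par y u) // (par z u) //; ring.
have sep : exists i j : 'X_{1..n}, [/\ i \in I, j \in I & (i t0)%:R != (j t0)%:R :> K].
  by exists i, j.
have [P PI nP] := noncollinear_irreducible no_var sep nc.
exact/nP/red.
Qed.
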